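(* Let $k_1,k_2:\Gamma_0\to\mathbb{R}$ be measurable functions. If the function $\widehat{k}(\eta^+,\eta^-):=k_1(\eta^+)\,k_2(\eta^-)$ is positive definite in the sense of Lenard on $\Gamma_0^2=\Gamma_0\times\Gamma_0$, then the function $k(\eta):=(k_1\ast k_2)(\eta)$ is positive definite in the sense of Lenard on $\Gamma_0$.
   Context: Setting. $X$ is a connected oriented non-compact Riemannian $C^\infty$-manifold with Borel $\sigma$-algebra $\mathcal{B}(X)$; $\mathcal{B}_{\mathrm c}(X)$ is the class of Borel sets with compact closure. $m$ is a non-atomic Radon measure on $X$ ($m(\Lambda)<\infty$ for $\Lambda\in\mathcal{B}_{\mathrm c}(X)$, $m(\{x\})=0$ for all $x$), and there is an increasing sequence $\Lambda_n\in\mathcal{B}_{\mathrm c}(X)$ with $\bigcup_n\Lambda_n=X$. Configurations. $\Gamma_0=\bigsqcup_{n\ge0}\Gamma^{(n)}$, where $\Gamma^{(n)}$ is the set of $n$-point subsets of $X$ (identified with $\{(x_1,\dots,x_n)\in X^n: x_k\ne x_l \text{ for } k\ne l\}/S_n$, with the induced quotient topology, $\Gamma_0$ carrying the disjoint union topology), $\Gamma^{(0)}=\{\emptyset\}$, with Borel $\sigma$-algebra $\mathcal{B}(\Gamma_0)$. For $\Lambda\in\mathcal{B}_{\mathrm c}(X)$, $\Gamma^{(n)}_\Lambda$ is the set of $n$-point subsets of $\Lambda$. $\lambda=\sum_{n\ge0}\frac{1}{n!}m^{(n)}$ is the Lebesgue–Poisson measure on $\Gamma_0$, where $m^{(n)}$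 is the image of $m^{\otimes n}$ on $\Gamma^{(n)}$ ($m^{(0)}(\{\emptyset\})=1$). $\Gamma$ is the set of all $\gamma\subset X$ with $|\gamma\cap\Lambda|<\infty$ for all $\Lambda\in\mathcal{B}_{\mathrm c}(X)$. $\Gamma_0^2=\Gamma_0\times\Gamma_0$ and $\Gamma^2=\Gamma\times\Gamma$; $\Gamma_0^2$ has the product $\sigma$-algebra. Convolution of functions: $(k_1\ast k_2)(\eta)=\sum_{\xi\subset\eta}k_1(\xi)\,k_2(\eta\setminus\xi)$, $\eta\in\Gamma_0$. Lenard positive definiteness on $\Gamma_0$. $B_{\mathrm{bs}}(\Gamma_0)$ is the class of bounded measurable $G:\Gamma_0\to\mathbb{R}$ vanishing outside some set $\bigsqcup_{n=0}^N\Gamma_\Lambda^{(n)}$, $\Lambda\in\mathcal{B}_{\mathrm c}(X)$, $N\in\mathbb{N}$. For such $G$, $(KG)(\gamma)=\sum_{\eta\subset\gamma,\,|\eta|<\infty}G(\eta)$, $\gamma\in\Gamma$. A function $k:\Gamma_0\to\mathbb{R}$ is positive definite in the sense of Lenard if for every $G\in B_{\mathrm{bs}}(\Gamma_0)$ with $(KG)(\gamma)\ge0$ for all $\gamma\in\Gamma$ one has $\int_{\Gamma_0}G(\eta)k(\eta)\,d\lambda(\eta)\ge0$. Lenard positive definiteness on $\Gamma_0^2$. $B_{\mathrm{bs}}(\Gamma_0^2)$ is the class of bounded measurable $G:\Gamma_0^2\to\mathbb{R}$ vanishing outside some set $\bigl(\bigsqcup_{n=0}^N\Gamma_\Lambda^{(n)}\bigr)\times\bigl(\bigsqcup_{n=0}^N\Gamma_\Lambda^{(n)}\bigr)$.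 For such $G$, $(\mathrm{K}G)(\gamma^+,\gamma^-)=\sum_{\eta^+\subset\gamma^+,\,|\eta^+|<\infty}\ \sum_{\eta^-\subset\gamma^-,\,|\eta^-|<\infty}G(\eta^+,\eta^-)$. A function $k:\Gamma_0^2\to\mathbb{R}$ is positive definite in the sense of Lenard if for every $G\in B_{\mathrm{bs}}(\Gamma_0^2)$ with $(\mathrm{K}G)(\gamma^+,\gamma^-)\ge0$ for all $(\gamma^+,\gamma^-)\in\Gamma^2$ one has $\int_{\Gamma_0}\int_{\Gamma_0}G(\eta^+,\eta^-)k(\eta^+,\eta^-)\,d\lambda(\eta^+)\,d\lambda(\eta^-)\ge0$. In both definitions it is understood that $Gk$ is integrable for every $G$ in the respective class $B_{\mathrm{bs}}$. *)

(* Defs.v *)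
From HB Require Import structures.
From mathcomp Require Export all_boot all_order all_algebra finmap.
From mathcomp Require Export all_classical all_reals all_analysis.

Set Implicit Arguments.
Unset Strict Implicit.
Unset Printing Implicit Defensive.

Import Order.TTheory GRing.Theory Num.Theory.
Import numFieldNormedType.Exports.

Local Open Scope classical_set_scope.
Local Open Scope ring_scope.

Definition partials (R : realType) (d : nat) (s : seq 'I_d)
    (f : 'rV[R]_d -> R) : 'rV[R]_d -> R :=
  foldr (fun i (g : 'rV[R]_d -> R) u => 'D_(delta_mx ord0 i) g u) f s.

(* [f] is of class C^oo on [U]; only meaningful for [U] open, since
   [partials s f] is computed with the values of [f] near each point. *)
Definition smooth_on (R : realType) (d : nat) (U : set 'rV[R]_d)
    (f : 'rV[R]_d -> R) : Prop :=
  forall (s : seq 'I_d) (u : 'rV[R]_d), U u ->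
    {for u, continuous (partials s f)} /\
    forall i : 'I_d, derivable (partials s f) u (delta_mx ord0 i).

Record chart (R : realType) (d : nat) (X : topologicalType) := Chart {
  cdom : set X;
  cmap : X -> 'rV[R]_d;
  cinv : 'rV[R]_d -> X;
  cdom_open : open cdom;
  cimg_open : open (cmap @` cdom);
  cmap_continuous : forall x, cdom x -> {for x, continuous cmap};
  cinv_continuous : forall u, (cmap @` cdom) u -> {for u, continuous cinv};
  cmapK : forall x, cdom x -> cinv (cmap x) = x
}.

Definition overlap (R : realType) (d : nat) (X : topologicalType)
  (c c' : chart R d X) : set 'rV[R]_d := cmap c @` (cdom c `&` cdom c').

Definition transition (R : realType) (d : nat) (X : topologicalType)
  (c c' : chart R d X) : 'rV[R]_d -> 'rV[R]_d := cmap c' \o cinv c.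

(* The atlas need not be maximal. Vectors are rows and [v *m 'J f u] is the
   differential of [f] at [u] applied to [v]; hence the form of
   [metric_change]. *)
Record oriented_riemannian_manifold (R : realType) (d : nat)
    (X : topologicalType) := OrientedRiemannianManifold {
  manifold_hausdorff : hausdorff_space X;
  manifold_second_countable : @second_countable X;
  atlas : set (chart R d X);
  atlas_cover : forall x, exists2 c, atlas c & cdom c x;
  atlas_smooth : forall c c', atlas c -> atlas c' -> forall j,
    smooth_on (overlap c c') (fun u => transition c c' u ord0 j);
  atlas_oriented : forall c c', atlas c -> atlas c' ->
    forall u, overlap c c' u -> 0 < \det ('J (transition c c') u);
  metric : chart R d X -> 'rV[R]_d -> 'M[R]_d;
  metric_smooth : forall c, atlas c -> forall i j,
    smooth_on (cmap c @` cdom c) (fun u => metric c u i j);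
  metric_sym : forall c, atlas c -> forall u, (cmap c @` cdom c) u ->
    (metric c u)^T = metric c u;
  metric_posdef : forall c, atlas c -> forall u, (cmap c @` cdom c) u ->
    forall v : 'rV[R]_d, v != 0 -> 0 < (v *m metric c u *m v^T) ord0 ord0;
  metric_change : forall c c', atlas c -> atlas c' ->
    forall u, overlap c c' u ->
    metric c u = 'J (transition c c') u *m metric c' (transition c c' u)
                 *m ('J (transition c c') u)^T
}.

Notation borel T := (g_sigma_algebraType (@open T)).

Definition Bc (X : ptopologicalType) : set (set X) :=
  [set L | measurable (L : set (borel X)) /\ compact (closure L)].

Definition Gamma0 (X : choiceType) := {fset X}.

HB.instance Definition _ (X : choiceType) := Pointed.on (Gamma0 X).

Definition distinct (X : topologicalType) (n : nat) :
  set (prod_topology (fun _ : 'I_n => X)) := [set f | injective f].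

Definition of_points (X : topologicalType) (n : nat)
  (f : subspace (@distinct X n)) : Gamma0 X := [fset x in codom f]%fset.

(* The final topology for the maps {n distinct points of X} -> Gamma0, i.e. the
   disjoint union of the quotient topologies. [subspace A] has the carrier of
   the ambient space; points outside [A] are isolated in it and so impose no
   condition. *)
Definition Gamma0_open (X : topologicalType) : set (set (Gamma0 X)) :=
  [set U | forall n, open (@of_points X n @^-1` U)].

Section Gamma0_topology.
Variable X : topologicalType.

Let Gamma0_openT : Gamma0_open (@setT (Gamma0 X)).
Proof. by move=> n; rewrite preimage_setT; exact: openT. Qed.

Let Gamma0_openI : setI_closed (@Gamma0_open X).
Proof. by move=> U V oU oV n; rewrite preimage_setI; exact: openI. Qed.

Let Gamma0_open_bigU (I : Type) (f : I -> set (Gamma0 X)) :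
  (forall i, Gamma0_open (f i)) -> Gamma0_open (\bigcup_i f i).
Proof.
by move=> fo n; rewrite preimage_bigcup; apply: bigcup_open => i _; exact: fo.
Qed.

HB.instance Definition _ := isOpenTopological.Build (Gamma0 X)
  Gamma0_openT Gamma0_openI Gamma0_open_bigU.

End Gamma0_topology.

Definition Gamma0_in (X : choiceType) (L : set X) (N : nat) :
  set (Gamma0 X) := [set eta | [set` eta] `<=` L /\ (#|` eta| <= N)%N].

Definition Gamma (X : ptopologicalType) : set (set X) :=
  [set g | forall L, Bc L -> finite_set (g `&` L)].

Section lebesgue_poisson.
Context (R : realType) (X : ptopologicalType).
Variable m : set (borel X) -> \bar R.
Local Open Scope ereal_scope.

(* [\x], [pushforward] and the integral take plain set functions; no measure
   instance is needed to write the following, and these are measures as soon as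
   [m] is a sigma-finite measure and [X] is Hausdorff and second countable. *)
Fixpoint power_measure (n : nat) : set (n.-tuple (borel X)) -> \bar R :=
  match n with
  | 0 => dirac ([tuple] : 0.-tuple (borel X))
  | n'.+1 => pushforward (m \x @power_measure n')
      (fun p : borel X * n'.-tuple (borel X) => [tuple of p.1 :: p.2])
  end.

(* The n-tuples with repeated points carry no configuration of size n. *)
Definition image_measure (n : nat) (A : set (borel (Gamma0 X))) : \bar R :=
  power_measure [set t : n.-tuple (borel X) |
    uniq t /\ A ([fset x in (t : seq X)]%fset : Gamma0 X)].

Definition lebesgue_poisson (A : set (borel (Gamma0 X))) : \bar R :=
  \sum_(0 <= n <oo) (n`!%:R^-1)%:E * image_measure n A.

End lebesgue_poisson.

Definition convolution (R : realType) (X : choiceType)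
    (k1 k2 : Gamma0 X -> R) (eta : Gamma0 X) : R :=
  \sum_(xi <- fpowerset eta) k1 xi * k2 (eta `\` xi)%fset.

Definition Bbs (R : realType) (X : ptopologicalType) :
    set (borel (Gamma0 X) -> R) :=
  [set G : borel (Gamma0 X) -> R | [/\
    measurable_fun [set: borel (Gamma0 X)] G,
    exists C : R, forall eta, `|G eta| <= C &
    exists L N, Bc L /\ forall eta, ~ Gamma0_in L N eta -> G eta = 0]].

(* A sum with finitely many nonzero terms when [G] is in [Bbs] and [g] is in
   [Gamma]. *)
Definition K_transform (R : realType) (X : ptopologicalType)
    (G : borel (Gamma0 X) -> R) (g : set X) : R :=
  \sum_(eta \in [set eta : Gamma0 X | [set` eta] `<=` g]) G eta.

(* Integrability of [G * k] for every [G] in [Bbs] is part of the notion. *)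
Definition lenard_posdef (R : realType) (X : ptopologicalType)
    (m : set (borel X) -> \bar R) (k : borel (Gamma0 X) -> R) : Prop :=
  forall G, Bbs G ->
    (lebesgue_poisson m).-integrable setT (fun eta => (G eta * k eta)%:E) /\
    ((forall g, Gamma g -> 0 <= K_transform G g) ->
     (0 <= \int[lebesgue_poisson m]_eta (G eta * k eta)%:E)%E).

Definition Bbs2 (R : realType) (X : ptopologicalType) :
    set (borel (Gamma0 X) * borel (Gamma0 X) -> R) :=
  [set G : borel (Gamma0 X) * borel (Gamma0 X) -> R | [/\
    measurable_fun [set: borel (Gamma0 X) * borel (Gamma0 X)] G,
    exists C : R, forall p, `|G p| <= C &
    exists L N, Bc L /\
      forall p, ~ (Gamma0_in L N `*` Gamma0_in L N) p -> G p = 0]].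

Definition K_transform2 (R : realType) (X : ptopologicalType)
    (G : borel (Gamma0 X) * borel (Gamma0 X) -> R) (gp gm : set X) : R :=
  \sum_(etap \in [set eta : Gamma0 X | [set` eta] `<=` gp])
    \sum_(etam \in [set eta : Gamma0 X | [set` eta] `<=` gm]) G (etap, etam).

Definition lenard_posdef2 (R : realType) (X : ptopologicalType)
    (m : set (borel X) -> \bar R)
    (k : borel (Gamma0 X) * borel (Gamma0 X) -> R) : Prop :=
  forall G, Bbs2 G ->
    (lebesgue_poisson m \x lebesgue_poisson m)%E.-integrable setT
      (fun p => (G p * k p)%:E) /\
    ((forall gp gm, Gamma gp -> Gamma gm -> 0 <= K_transform2 G gp gm) ->
     (0 <= \int[lebesgue_poisson m]_etam \int[lebesgue_poisson m]_etap
             (G (etap, etam) * k (etap, etam))%:E)%E).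

(* Main.v *)
(* The idea is to replace [G] on configurations by
   [(eta+, eta-) |-> (-1)^|eta+ /\ eta-| G (eta+ \/ eta-)] on pairs. By
   inclusion-exclusion its K-transform at [(gamma+, gamma-)] is the K-transform
   of [G] at [gamma+ \/ gamma-], also when [gamma+] and [gamma-] meet, so
   positivity is inherited. Since [m] has no atoms, almost all pairs are
   disjoint, and there the sign is 1: integrating against [k1 (x) k2] gives
   [int G (k1 * k2) d lambda] by the identity
     [int sum_(xi c eta) f (xi, eta \ xi) d lambda
      = int int f d lambda d lambda].
   Everything measure-theoretic is done on ordered tuples: a set of
   configurations is Borel iff the set of tuples of distinct points enumerating
   its elements is measurable, the space being second countable and
   Hausdorff. *)
From HB Require Import structures.
Require Import Defs.
From mathcomp Require Import measurable_realfun.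

Import Order.TTheory GRing.Theory Num.Theory.
Import numFieldNormedType.Exports.
Local Open Scope classical_set_scope.
Local Open Scope ring_scope.

Set Implicit Arguments.
Unset Strict Implicit.
Unset Printing Implicit Defensive.

(** * Sums over subsets *)

(** The hypothesis asks for a nonnegative K-transform at every pair of [Gamma], overlapping pairs
    included, although the overlapping finite pairs are null for the integral. Without a sign,
    [G (eta+ \/ eta-)] would count a configuration once for each way to cover it by a part of
    [gamma+] and a part of [gamma-]. A point common to both can be covered in three ways, which the
    sign weights 1 + 1 - 1 = 1. The price is measurability: the size of the union jumps where the
    two configurations meet, so over pairs of tuples the union has no enumeration of fixed length.
    Hence the recursion behind [phi], which decides point by point whether it is shared; these
    decisions are measurable because the diagonal lies in the product sigma-algebra. The integral
    identity is a statement about nonnegative functions. It is applied to the positive and negative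
    parts of the signed union times [k1 (x) k2], whose integrability is part of the notion on pairs;
    integrability on single configurations results from it. *)

Section finite_subset_sums.
Local Open Scope fset_scope.
Variables (K : choiceType) (V : nmodType).
Implicit Types (x : K) (A B : {fset K}).

Lemma fpowersetU1 x A :
  fpowerset (x |` A) = fpowerset A `|` [fset x |` B | B in fpowerset A].
Proof.
apply/fsetP => B; rewrite !inE !fpowersetE; apply/idP/orP => [BxA|].
  have [xB|xB] := boolP (x \in B); [right|left].
    apply/imfsetP; exists (B `\ x); last by rewrite fsetD1K.
    by rewrite /= fpowersetE fsubDset.
  apply/fsubsetP => y yB; have := fsubsetP BxA y yB.
  by rewrite !inE => /predU1P[yx|//]; rewrite -yx yB in xB.
case=> [BA|/imfsetP[C /=]]; first exact: fsubset_trans BA (fsubsetU1 _ _).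
by rewrite fpowersetE => CA ->; rewrite fsetUS.
Qed.

Lemma big_fpowersetU1 x A (f : {fset K} -> V) : x \notin A ->
  \sum_(B <- fpowerset (x |` A)) f B =
  \sum_(B <- fpowerset A) (f B + f (x |` B))%R.
Proof.
move=> xA; have xN B : B \in fpowerset A -> x \notin B.
  by rewrite fpowersetE => /fsubsetP BA; apply: contra xA; exact: BA.
rewrite big_split /= [LHS](big_fsetID _ (fun B : {fset K} => x \notin B)).
transitivity (\sum_(B <- fpowerset A) f B +
              \sum_(B <- [fset x |` B | B in fpowerset A]) f B)%R; last first.
  congr (_ + _)%R; rewrite big_imfset //= => B C BA CA e.
  by rewrite -(fsetU1K (xN _ BA)) -(fsetU1K (xN _ CA)) e.
congr (_ + _)%R; apply: eq_fbigl => B; rewrite !inE fpowersetU1 inE.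
  apply/andP/idP => [[/orP[//|/imfsetP[C CA ->]]]|BA]; first by rewrite fset1U1.
  by rewrite BA xN.
rewrite negbK; apply/andP/idP => [[/orP[BA xB|//]]|BA].
  by rewrite (negbTE (xN _ BA)) in xB.
by rewrite BA orbT; move/imfsetP: BA => [C _ ->]; rewrite fset1U1.
Qed.

End finite_subset_sums.

(* The sum over the subsets of a finite set, read on an enumeration [u] of it:
   [u] is split into complementary subsequences. *)
Fixpoint split_sum (T : Type) (V : nmodType) (F : seq T -> seq T -> V)
    (u : seq T) : V :=
  if u is x :: u' then split_sum (fun s t => F (x :: s) t) u' +
                       split_sum (fun s t => F s (x :: t)) u'
  else F [::] [::].

(** Quantified over [f], so that in the induction the head [x] is absorbed into one of the two
    arguments of [f]. *)
Lemma split_sum_uniq (K : choiceType) (V : nmodType)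
    (f : {fset K} -> {fset K} -> V) (u : seq K) : uniq u ->
  split_sum (fun s t => f [fset x in s]%fset [fset x in t]%fset) u =
  \sum_(xi <- fpowerset [fset x in u]%fset) f xi ([fset x in u] `\` xi)%fset.
Proof.
have fset_nil : [fset x in [::]]%fset = fset0 :> {fset K}.
  by apply/fsetP => x; rewrite !inE.
elim: u f => [|x u IH] f /=.
  by rewrite !fset_nil fpowerset0 big_seq_fset1 fset0D.
case/andP=> xu uu.
have xA : x \notin [fset y in u]%fset by rewrite inE.
have E : [fset y in x :: u]%fset = (x |` [fset y in u])%fset.
  by apply/fsetP => y; rewrite !inE.
rewrite E big_fpowersetU1 // big_split /= addrC; congr (_ + _).
- rewrite (_ : (fun _ _ => _) = (fun s t => (fun a b => f a (x |` b)%fset)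
     [fset y in s]%fset [fset y in t]%fset)); last first.
    apply/funext => s; apply/funext => t; congr (f _ _).
    by apply/fsetP => y; rewrite !inE.
  rewrite (IH (fun a b => f a (x |` b)%fset)) //.
  apply: eq_big_seq => B; rewrite fpowersetE => /fsubsetP BA.
  congr (f _ _); apply/fsetP => y; rewrite !inE.
  case: eqP => //= ->; case: (boolP (x \in B)) => // /BA.
  by rewrite (negbTE xA).
- rewrite (_ : (fun _ _ => _) = (fun s t => (fun a b => f (x |` a)%fset b)
     [fset y in s]%fset [fset y in t]%fset)); last first.
    apply/funext => s; apply/funext => t; congr (f _ _).
    by apply/fsetP => y; rewrite !inE.
  rewrite (IH (fun a b => f (x |` a)%fset b)) //.
  apply: eq_big_seq => B; rewrite fpowersetE => /fsubsetP BA.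
  congr (f _ _); apply/fsetP => y; rewrite !inE negb_or.
  by case: eqP => //= ->; rewrite (negbTE xu) andbF.
Qed.

(** Pascal's rule in the shape in which it arises for integrals: of [n + 1] coordinates the first is
    peeled off and joins the left block in the first sum, the right block in the second. *)
Lemma binomial_pascal_sum (V : nmodType) (a : nat -> nat -> V) (n : nat) :
  \sum_(k < n.+1) (a k.+1 (n - k)%N *+ 'C(n, k)) +
  \sum_(k < n.+1) (a k (n - k).+1 *+ 'C(n, k)) =
  \sum_(k < n.+2) (a k (n.+1 - k)%N *+ 'C(n.+1, k)).
Proof.
rewrite [RHS]big_ord_recl /= bin0 subn0.
under [X in _ = _ + X]eq_bigr => k _.
  rewrite /bump /= add1n binS subSS mulrnDr addrC; over.
rewrite big_split /= [in LHS]addrC [X in X + _]big_ord_recl /= bin0 subn0 -addrA.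
congr (_ + _); rewrite addrC; congr (_ + _).
rewrite big_ord_recr /= bin_small // mulr0n addr0.
apply: eq_bigr => k _; rewrite /bump /= add1n.
by rewrite -subSn.
Qed.

(** A point of [c] common to [P] and [Q] can come from [a] alone, from [b] alone or from both, with
    weights 1, 1 and -1; hence each [c] is counted once. *)
Lemma sum_fpowersetU_alternating (K : choiceType) (S : comPzRingType)
    (P Q : {fset K}) (g : {fset K} -> S) :
  \sum_(a <- fpowerset P) \sum_(b <- fpowerset Q)
    (-1) ^+ #|` (a `&` b)%fset| * g (a `|` b)%fset =
  \sum_(c <- fpowerset (P `|` Q)%fset) g c.
Proof.
elim/fset1U_rect: P g => [|x P xP IH] g.
  rewrite fpowerset0 big_seq_fset1 fset0U; apply: eq_bigr => b _.
  by rewrite fset0I cardfs0 expr0 mul1r fset0U.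
rewrite big_fpowersetU1 // big_split /= IH -fsetUA.
have xN a : a \in fpowerset P -> x \notin a.
  by rewrite fpowersetE => /fsubsetP aP; apply: contra xP; exact: aP.
have [xQ|xQ] := boolP (x \in Q).
  have xPQ : x \in (P `|` Q)%fset by rewrite inE xQ orbT.
  have -> : (x |` (P `|` Q) = P `|` Q)%fset.
    by apply/fsetUidPr; rewrite fsub1set.
  (* For [x] in [Q] the terms with [x] in [a] cancel in pairs: adding [x] to [b] leaves the union
     fixed and flips the sign. *)
  rewrite [X in _ + X]big_seq [X in _ + X]big1 ?addr0 // => a aP.
  rewrite -(fsetD1K xQ) big_fpowersetU1 ?in_fsetD1 ?eqxx //.
  apply: big1_seq => b /andP[_]; rewrite fpowersetE => /fsubsetP bQ.
  have xb : x \notin b by apply/negP => /bQ; rewrite in_fsetD1 eqxx.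
  have -> : ((x |` a) `&` b = a `&` b)%fset.
    apply/fsetP => y; rewrite !inE; case: eqP => //= ->.
    by rewrite (negbTE xb) andbF.
  have -> : ((x |` a) `&` (x |` b) = x |` (a `&` b))%fset.
    by rewrite fsetUIr.
  have -> : ((x |` a) `|` (x |` b) = (x |` a) `|` b)%fset.
    by rewrite fsetUCA fsetUA fsetUA fsetUid.
  rewrite cardfsU1 !inE (negbTE (xN _ aP)) /= add1n exprS mulN1r mulNr.
  by rewrite subrr.
have xPQ : x \notin (P `|` Q)%fset by rewrite inE negb_or xP xQ.
rewrite big_fpowersetU1 // big_split /=; congr (_ + _).
rewrite -(IH (fun a => g (x |` a)%fset)); apply: eq_bigr => a _.
apply: eq_big_seq => b; rewrite fpowersetE => /fsubsetP bQ.
have xb : x \notin b by apply: contra xQ; exact: bQ.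
congr (_ ^+ _ * _); last by rewrite fsetUA.
congr #|` _|; apply/fsetP => y; rewrite !inE; case: eqP => //= ->.
by rewrite (negbTE xb) andbF.
Qed.

Section sigma_finite_packing.
Context d (T : measurableType d) (R : realType).
Variables (mu : {measure set T -> \bar R}) (smu : sigma_finite setT mu).

Let nu : set T -> \bar R := mu.
HB.instance Definition _ := Measure.on nu.
HB.instance Definition _ := Measure_isSigmaFinite.Build _ _ _ nu smu.

(** Tonelli's theorem takes bundled sigma-finite measures; a measure is traded here for a bundled
    one, equal as a set function, once sigma-finiteness has been proved. *)
Lemma sigma_finite_measure_of :
  exists nu' : {sigma_finite_measure set T -> \bar R},
    nu' = mu :> (set T -> \bar R).
Proof. by exists (nu : {sigma_finite_measure set T -> \bar R}). Qed.

End sigma_finite_packing.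

Section sequence_measurability.
Context d (T : measurableType d) (R : realType).
Local Open Scope ereal_scope.

(* The parameter space [P] is what inductions on the sequences move points to. *)
Definition seq_measurable d' (P : measurableType d')
    (F : P -> seq T -> seq T -> \bar R) :=
  forall k l, measurable_fun setT
    (fun q : P * k.-tuple T * l.-tuple T => F q.1.1 q.1.2 q.2).

Lemma measurable_thead n : measurable_fun setT (@thead n T).
Proof. exact: measurable_tnth. Qed.

Lemma seq_measurable_consl d' (P : measurableType d')
    (F : P -> seq T -> seq T -> \bar R) : seq_measurable F ->
  seq_measurable (fun (p : P * T) s t => F p.1 (p.2 :: s) t).
Proof.
move=> mF k l.
pose h (q : P * T * k.-tuple T * l.-tuple T) :=
  (q.1.1.1, [the k.+1.-tuple T of q.1.1.2 :: q.1.2], q.2).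
apply: (@measurableT_comp _ _ _ _ _ _ _ _ h (mF k.+1 l)).
apply: measurable_fun_pair => //; apply: measurable_fun_pair.
  by do 2 (apply: measurableT_comp => //).
by apply: measurable_cons; do ?[apply: measurableT_comp => //].
Qed.

Lemma seq_measurable_consr d' (P : measurableType d')
    (F : P -> seq T -> seq T -> \bar R) : seq_measurable F ->
  seq_measurable (fun (p : P * T) s t => F p.1 s (p.2 :: t)).
Proof.
move=> mF k l.
pose h (q : P * T * k.-tuple T * l.-tuple T) :=
  (q.1.1.1, q.1.2, [the l.+1.-tuple T of q.1.1.2 :: q.2]).
apply: (@measurableT_comp _ _ _ _ _ _ _ _ h (mF k l.+1)).
apply: measurable_fun_pair; first apply: measurable_fun_pair.
- by do 2 (apply: measurableT_comp => //).
- by apply: measurableT_comp.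
by apply: measurable_cons; do ?[apply: measurableT_comp => //].
Qed.

Lemma measurable_split_sum n d' (P : measurableType d')
    (F : P -> seq T -> seq T -> \bar R) : seq_measurable F ->
  measurable_fun setT (fun q : P * n.-tuple T => split_sum (F q.1) q.2).
Proof.
elim: n d' P F => [|n IH] d' P F mF.
  pose h (q : P * 0.-tuple T) := (q.1, q.2, q.2).
  rewrite (_ : (fun _ => _) = (fun q : P * 0.-tuple T * 0.-tuple T =>
     F q.1.1 q.1.2 q.2) \o h); last first.
    by apply/funext => -[p t]; rewrite /= tuple0.
  apply: measurableT_comp; first exact: mF.
  by apply: measurable_fun_pair => //; exact: measurable_fun_pair.
pose h (q : P * n.+1.-tuple T) :=
  (q.1, thead q.2, [tuple of behead q.2] : n.-tuple T).
have mh : measurable_fun setT h.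
  apply: measurable_fun_pair; first apply: measurable_fun_pair => //.
    exact: (@measurableT_comp _ _ _ _ _ _ _ _ snd (@measurable_thead n)).
  exact: (@measurableT_comp _ _ _ _ _ _ _ _ snd (@measurable_behead _ _ n)).
rewrite (_ : (fun _ => _) = (fun q : P * n.+1.-tuple T =>
   split_sum (fun s t => F (h q).1.1 ((h q).1.2 :: s) t) (h q).2 +
   split_sum (fun s t => F (h q).1.1 s ((h q).1.2 :: t)) (h q).2)); last first.
  by apply/funext => -[p t]; rewrite /= [in LHS](tuple_eta t).
apply: emeasurable_funD.
- have := IH _ _ _ (seq_measurable_consl mF).
  by move=> /(@measurableT_comp _ _ _ _ _ _ _ _ h)/(_ mh).
- have := IH _ _ _ (seq_measurable_consr mF).
  by move=> /(@measurableT_comp _ _ _ _ _ _ _ _ h)/(_ mh).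
Qed.

Lemma split_sum_ge0 (F : seq T -> seq T -> \bar R) u :
  (forall s t, 0 <= F s t) -> 0 <= split_sum F u.
Proof.
elim: u F => //= x u IH F F0.
by apply: adde_ge0; apply: IH => s t; exact: F0.
Qed.

End sequence_measurability.

(** * Integrals over tuples *)

Section power_measure_theory.
Context (R : realType) (X : ptopologicalType).
Variable m : {sigma_finite_measure set (borel X) -> \bar R}.
Local Open Scope ereal_scope.
Local Notation T := (borel X).

Let tcons n (p : T * n.-tuple T) : n.+1.-tuple T := [tuple of p.1 :: p.2].

Let measurable_tcons n : measurable_fun setT (@tcons n).
Proof. exact: measurable_cons. Qed.

Lemma power_measure_sigma_finite n :
  exists mu : {sigma_finite_measure set (n.-tuple T) -> \bar R},
    mu = @power_measure R X m n :> (set (n.-tuple T) -> \bar R).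
Proof.
elim: n => [|n [mu IH]].
  pose mu : {measure set (0.-tuple T) -> \bar R} :=
    dirac ([tuple] : 0.-tuple (borel X)).
  apply: (@sigma_finite_measure_of _ _ _ mu).
  exists (fun=> setT); first by rewrite bigcup_const.
  by move=> _; split => //=; rewrite diracT ltry.
rewrite /= -IH.
pose nu : {measure set (n.+1.-tuple T) -> \bar R} :=
  measure_function_pushforward__canonical__measure_function_Measure
    (m \x mu) (@measurable_tcons n).
apply: (@sigma_finite_measure_of _ _ _ nu).
have /sigma_finiteP[F [UF ndF mF]] := sigma_finiteT m.
have /sigma_finiteP[G [UG ndG mG]] := sigma_finiteT mu.
(* Both exhaustions increase, so a single index serves head and tail. *)
exists (fun k => [set t | F k (thead t) /\ G k [tuple of behead t]]).
  apply/seteqP; split => // t _.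
  have [i _ Fi] : (\bigcup_k F k) (thead t) by rewrite -UF.
  have [j _ Gj] : (\bigcup_k G k) [tuple of behead t] by rewrite -UG.
  exists (maxn i j) => //; split.
    by move: Fi; exact/subsetPset/ndF/leq_maxl.
  by move: Gj; exact/subsetPset/ndG/leq_maxr.
move=> k; have [mFk Fk] := mF k; have [mGk Gk] := mG k; split.
  apply: measurableI; rewrite -[X in measurable X]setTI.
    exact: (@measurable_thead _ T n).
  exact: (@measurable_behead _ T n).
rewrite [ltLHS](_ : _ = (m \x mu) (F k `*` G k)); last first.
  rewrite /nu /= /pushforward; congr ((m \x mu) _).
  by apply/seteqP; split => -[x t] /=; rewrite theadE (_ : [tuple of _] = t) //;
    exact: val_inj.
by rewrite product_measure1E // lte_mul_pinfty // ge0_fin_numE.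
Qed.

Definition tuple_measure n : {sigma_finite_measure set (n.-tuple T) -> \bar R} :=
  sval (cid (power_measure_sigma_finite n)).

Lemma tuple_measureE n :
  tuple_measure n = @power_measure R X m n :> (set (n.-tuple T) -> \bar R).
Proof. by rewrite /tuple_measure; case: cid. Qed.

Lemma integral_tuple0 (f : 0.-tuple T -> \bar R) :
  \int[tuple_measure 0]_t f t = f [tuple].
Proof.
have -> : f = cst (f [tuple]) by apply/funext => t; rewrite /= tuple0.
by rewrite tuple_measureE integral_dirac //= diracT mul1e.
Qed.

Lemma integral_tupleS n (f : n.+1.-tuple T -> \bar R) :
  measurable_fun setT f -> (forall t, 0 <= f t) ->
  \int[tuple_measure n.+1]_t f t =
  \int[m]_x \int[tuple_measure n]_t f [tuple of x :: t].
Proof.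
move=> mf f0; rewrite tuple_measureE /= -tuple_measureE.
rewrite (ge0_integral_pushforward (@measurable_tcons n)) //=.
rewrite preimage_setT.
apply: (etrans (fubini_tonelli1 (f \o @tcons n)
  (measurableT_comp mf (@measurable_tcons n)) _)) => // x.
exact: f0.
Qed.

Definition split_integral (F : seq T -> seq T -> \bar R) (k l : nat) :=
  \int[tuple_measure k]_s \int[tuple_measure l]_t F s t.

Section parametric.
Context d (P : measurableType d).
Variable F : P -> seq T -> seq T -> \bar R.
Hypotheses (mF : seq_measurable F) (F0 : forall p s t, 0 <= F p s t).

Lemma measurable_inner_integral k l : measurable_fun setT
  (fun q : P * k.-tuple T => \int[tuple_measure l]_t F q.1 q.2 t).
Proof.
apply: (measurable_fun_fubini_tonelli_F
  (fun q : P * k.-tuple T * l.-tuple T => F q.1.1 q.1.2 q.2)) => //.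
exact: mF.
Qed.

Lemma measurable_split_integral k l :
  measurable_fun setT (fun p => split_integral (F p) k l).
Proof.
apply: (measurable_fun_fubini_tonelli_F
  (fun q : P * k.-tuple T => \int[tuple_measure l]_t F q.1 q.2 t)).
  exact: measurable_inner_integral.
by move=> q; apply: integral_ge0.
Qed.

Lemma seq_measurable_at p : seq_measurable (fun _ : unit => F p).
Proof.
move=> k l.
pose h (q : unit * k.-tuple T * l.-tuple T) := (p, q.1.2, q.2).
apply: (@measurableT_comp _ _ _ _ _ _ _ _ h (@mF k l)).
apply: measurable_fun_pair => //; apply: measurable_fun_pair => //.
by apply: measurableT_comp.
Qed.

End parametric.

Lemma seq_measurable_unit d (P : measurableType d) (F : seq T -> seq T -> \bar R) :
  seq_measurable (fun _ : unit => F) -> seq_measurable (fun _ : P => F).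
Proof.
move=> mF k l.
pose h (q : P * k.-tuple T * l.-tuple T) := (tt, q.1.2, q.2).
apply: (@measurableT_comp _ _ _ _ _ _ _ _ h (@mF k l)).
apply: measurable_fun_pair => //; apply: measurable_fun_pair => //.
by apply: measurableT_comp.
Qed.

Section split_integral_identity.
Implicit Types F : seq T -> seq T -> \bar R.

Lemma split_integral_consl F k l : seq_measurable (fun _ : unit => F) ->
  (forall s t, 0 <= F s t) ->
  \int[m]_x split_integral (fun s t => F (x :: s) t) k l =
  split_integral F k.+1 l.
Proof.
move=> mF F0; rewrite /split_integral integral_tupleS //.
  have mI := measurable_inner_integral mF (fun _ => F0) (k := k.+1) l.
  pose h (s : k.+1.-tuple T) := (tt, s).
  apply: (@measurableT_comp _ _ _ _ _ _ _ _ h mI).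
  exact: measurable_fun_pair.
by move=> s; apply: integral_ge0.
Qed.

(** [x] is integrated outermost but belongs to the inner block, so Tonelli has to move it past
    [s]. *)
Lemma split_integral_consr F k l : seq_measurable (fun _ : unit => F) ->
  (forall s t, 0 <= F s t) ->
  \int[m]_x split_integral (fun s t => F s (x :: t)) k l =
  split_integral F k l.+1.
Proof.
move=> mF F0; rewrite /split_integral.
have mF2 := seq_measurable_consr (seq_measurable_unit (P := unit) mF).
transitivity (\int[tuple_measure k]_s \int[m]_x
    \int[tuple_measure l]_t F s (x :: t)).
  apply: (fubini_tonelli
    (fun q : T * k.-tuple T => \int[tuple_measure l]_t F q.2 (q.1 :: t))).
    have mI := measurable_inner_integral mF2 (fun _ _ _ => F0 _ _) (k := k) l.
    pose h (q : T * k.-tuple T) := ((tt, q.1), q.2).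
    apply: (@measurableT_comp _ _ _ _ _ _ _ _ h mI).
    by apply: measurable_fun_pair => //; exact: measurable_fun_pair.
  by move=> q; apply: integral_ge0.
apply: eq_integral => s _; rewrite integral_tupleS //.
pose h (t : l.+1.-tuple T) := (tt, s : k.-tuple T, t).
apply: (@measurableT_comp _ _ _ _ _ _ _ _ h (mF k l.+1)).
by apply: measurable_fun_pair => //; exact: measurable_fun_pair.
Qed.

Lemma integral_natmul d (S : measurableType d) (mu : {measure set S -> \bar R})
    (f : S -> \bar R) n : measurable_fun setT f -> (forall x, 0 <= f x) ->
  \int[mu]_x (f x *+ n)%R = ((\int[mu]_x f x)%E *+ n)%R.
Proof.
move=> mf f0; rewrite -[n in RHS]card_ord -sumr_const.
rewrite -(ge0_integral_sum mu measurableT) //.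
by apply: eq_integral => x _; rewrite sumr_const card_ord.
Qed.

Lemma measurable_split_sum_tuple n F : seq_measurable (fun _ : unit => F) ->
  measurable_fun setT (fun u : n.-tuple T => split_sum F u).
Proof.
move=> mF; pose h (u : n.-tuple T) := (tt, u).
apply: (@measurableT_comp _ _ _ _ _ _ _ _ h (measurable_split_sum mF)).
exact: measurable_fun_pair.
Qed.

Lemma split_integral_ge0 F k l : (forall s t, 0 <= F s t) ->
  0 <= split_integral F k l.
Proof. by move=> F0; do 2 (apply: integral_ge0 => ? _). Qed.

Lemma natmule_ge0 (x : \bar R) n : 0 <= x -> 0 <= (x *+ n)%R.
Proof. by move=> x0; elim: n => // n IH; rewrite mulrS adde_ge0. Qed.

(* Peeling off the first coordinate, which goes to either side, gives Pascal's
   rule; in particular the symmetry of the power measures is not needed. *)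
Lemma integral_split_sum n F : seq_measurable (fun _ : unit => F) ->
  (forall s t, 0 <= F s t) ->
  \int[tuple_measure n]_u split_sum F u =
  (\sum_(k < n.+1) split_integral F k (n - k)%N *+ 'C(n, k))%R.
Proof.
elim: n F => [|n IH] F mF F0.
  rewrite big_ord1 /= mulr1n /split_integral.
  rewrite (integral_tuple0 (fun u : 0.-tuple T => split_sum F u)).
  rewrite (integral_tuple0 (fun s : 0.-tuple T =>
    \int[tuple_measure 0]_t F s t)).
  by rewrite (integral_tuple0 (fun t : 0.-tuple T => F [tuple] t)).
have mFl := seq_measurable_consl mF.
have mFr := seq_measurable_consr mF.
have mint (G : unit * T -> seq T -> seq T -> \bar R) k l : seq_measurable G ->
    (forall p s t, 0 <= G p s t) ->
    measurable_fun setT (fun x => split_integral (G (tt, x)) k l).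
  move=> mG G0; pose h (x : T) := (tt, x).
  apply: (@measurableT_comp _ _ _ _ _ _ _ _ h (measurable_split_integral mG G0 _ _)).
  exact: measurable_fun_pair.
rewrite (integral_tupleS (f := fun u : n.+1.-tuple T => split_sum F u)); last 2 first.
- exact: (measurable_split_sum_tuple mF).
- by move=> t; exact: split_sum_ge0.
transitivity (\int[m]_x
  (\sum_(k < n.+1) split_integral (fun s t => F (x :: s) t) k (n - k)%N *+ 'C(n, k) +
   \sum_(k < n.+1) split_integral (fun s t => F s (x :: t)) k (n - k)%N *+ 'C(n, k))%R).
  apply: eq_integral => x _ /=.
  have mFlx := seq_measurable_at mFl (tt, x).
  have mFrx := seq_measurable_at mFr (tt, x).
  rewrite -!IH //; apply: ge0_integralD => //.
  + by move=> t _; apply: split_sum_ge0.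
  + exact: (measurable_split_sum_tuple mFlx).
  + by move=> t _; apply: split_sum_ge0.
  + exact: (measurable_split_sum_tuple mFrx).
have mnat (f : T -> \bar R) i : measurable_fun setT f ->
    measurable_fun setT (fun x => (f x *+ i)%R).
  move=> mf; elim: i => [|i IHi].
    exact: measurable_cst.
  by under eq_fun do rewrite mulrS; exact: emeasurable_funD.
rewrite ge0_integralD //; last 4 first.
- by move=> x _; apply: sume_ge0 => k _; exact/natmule_ge0/split_integral_ge0.
- by apply: emeasurable_sum => k; apply: mnat; exact: (mint _ _ _ mFl).
- by move=> x _; apply: sume_ge0 => k _; exact/natmule_ge0/split_integral_ge0.
- by apply: emeasurable_sum => k; apply: mnat; exact: (mint _ _ _ mFr).
rewrite -binomial_pascal_sum; congr (_ + _).
- rewrite ge0_integral_sum //; last 2 first.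
  + by move=> k; apply: mnat; exact: (mint _ _ _ mFl).
  + by move=> k x _; exact/natmule_ge0/split_integral_ge0.
  apply: eq_bigr => k _; rewrite integral_natmul; last 2 first.
  + exact: (mint _ _ _ mFl).
  + by move=> x; exact: split_integral_ge0.
  by rewrite split_integral_consl.
- rewrite ge0_integral_sum //; last 2 first.
  + by move=> k; apply: mnat; exact: (mint _ _ _ mFr).
  + by move=> k x _; exact/natmule_ge0/split_integral_ge0.
  apply: eq_bigr => k _; rewrite integral_natmul; last 2 first.
  + exact: (mint _ _ _ mFr).
  + by move=> x; exact: split_integral_ge0.
  by rewrite split_integral_consr.
Qed.

End split_integral_identity.
End power_measure_theory.

(** * The Borel sets of the space of finite configurations *)

Section measurable_membership.
Context d (T : measurableType d).
Hypothesis measurable_diag : measurable [set p : T * T | p.1 = p.2].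

Lemma measurable_eq d' (P : measurableType d') (f g : P -> T) :
  measurable_fun setT f -> measurable_fun setT g ->
  measurable_fun setT (fun p => f p == g p).
Proof.
move=> mf mg; apply: (measurable_fun_bool true).
rewrite setTI (_ : _ @^-1` _ = (fun p => (f p, g p)) @^-1` [set p | p.1 = p.2]).
  by rewrite -[X in measurable X]setTI; exact: measurable_fun_pair.
by apply/seteqP; split => p /eqP.
Qed.

Lemma measurable_in_tuple n d' (P : measurableType d') (f : P -> T)
    (g : P -> n.-tuple T) :
  measurable_fun setT f -> measurable_fun setT g ->
  measurable_fun setT (fun p => f p \in g p).
Proof.
move=> mf; elim: n g => [|n IH] g mg.
  by under eq_fun do rewrite tuple0 in_nil; exact: measurable_cst.
under eq_fun do rewrite (tuple_eta (g _)) in_cons.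
apply: measurable_or.
  apply: measurable_eq => //.
  exact: measurableT_comp (@measurable_thead _ T n) mg.
apply: (IH (fun p => [tuple of behead (g p)])).
exact: measurableT_comp (@measurable_behead _ T n) mg.
Qed.

Lemma measurable_uniq n d' (P : measurableType d') (g : P -> n.-tuple T) :
  measurable_fun setT g -> measurable_fun setT (fun p => uniq (g p)).
Proof.
elim: n g => [|n IH] g mg.
  by under eq_fun do rewrite tuple0; exact: measurable_cst.
have mh : measurable_fun setT (fun p => [tuple of behead (g p)] : n.-tuple T).
  exact: measurableT_comp (@measurable_behead _ T n) mg.
have mt : measurable_fun setT (fun p => thead (g p)).
  exact: measurableT_comp (@measurable_thead _ T n) mg.
under eq_fun do rewrite (tuple_eta (g _)) cons_uniq.
apply: measurable_and; last exact: (IH _ mh).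
apply: measurable_neg.
exact: (measurable_in_tuple mt mh).
Qed.

End measurable_membership.

Section finite_configurations.
Variable X : ptopologicalType.
Hypotheses (hX : hausdorff_space X) (cX : @second_countable X).
Local Notation T := (borel X).
Local Notation Gam := (borel (Gamma0 X)).

Lemma second_countable_enum : exists b : nat -> set X,
  (forall k, open (b k)) /\
  forall x V, nbhs x V -> exists2 k, b k x & b k `<=` V.
Proof.
have [B /countable_injP[f finj] [Bo Bn]] := cX.
(* A number that codes no basic set yields the empty set, which makes [b] a total sequence. *)
pose b k := [set x | exists U, [/\ B U, f U = k & U x]].
have bE U : B U -> b (f U) = U.
  move=> BU; apply/seteqP; split => [x [U' [BU' e U'x]]|x Ux]; last by exists U.
  by rewrite -(finj _ _ _ _ e) ?inE.
exists b; split => [k|x V /Bn [U [BU Ux] UV]].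
  have [[U [BU <-]]|nU] := pselect (exists U, B U /\ f U = k).
    by rewrite bE //; exact: Bo.
  rewrite (_ : b k = set0); first exact: open0.
  by apply/seteqP; split => // x [U [BU e _]]; apply: nU; exists U.
by exists (f U); rewrite bE.
Qed.

(** The boxes around [f] generate a filter. Its convergence to [f] in a supremum of topologies can
    be tested on each projection, where a box with one nontrivial side suffices. *)
Lemma nbhs_prod_box n (f : prod_topology (fun _ : 'I_n => X)) V : nbhs f V ->
  exists2 w : 'I_n -> set X, (forall i, nbhs (f i) (w i)) &
    [set g | forall i, w i (g i)] `<=` V.
Proof.
pose F : set_system (prod_topology (fun _ : 'I_n => X)) :=
  filter_from [set w : 'I_n -> set X | forall i, nbhs (f i) (w i)]
              (fun w => [set g | forall i, w i (g i)]).
have FF : Filter F.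
  apply: filter_from_filter; first by exists (fun=> setT) => i; exact: filterT.
  move=> w w' fw fw'; exists (fun i => w i `&` w' i).
    by move=> i; exact: filterI.
  by move=> g h; split => i; have [] := h i.
have : F --> f.
  apply/cvg_sup => i U /= [_ [[A oA <-] /= Af] AU].
  exists (fun j => if j == i then A else setT).
    move=> j; case: eqP => [->|_]; last exact: filterT.
    exact: open_nbhs_nbhs.
  by move=> g /(_ i); rewrite eqxx => ?; exact: AU.
by move=> /[apply].
Qed.

(** An open set of the product is the union of the boxes of basic sets inside it, and these boxes
    are indexed by the countable type of functions from ['I_n] to [nat]. *)
Lemma measurable_open_tuple n (V : set (prod_topology (fun _ : 'I_n => X))) :
  open V -> measurable [set t : n.-tuple T | V (tnth t)].
Proof.
move=> oV; have [b [bo bn]] := second_countable_enum.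
pose box (w : {ffun 'I_n -> nat}) := [set g : 'I_n -> X | forall i, b (w i) (g i)].
rewrite (_ : mkset _ = \bigcup_w
    [set t : n.-tuple T | box w (tnth t) /\ box w `<=` V]).
  apply: countable_bigcupT_measurable; first exact: countableP.
  move=> w; have [wV|wV] := pselect (box w `<=` V); last first.
    by rewrite (_ : mkset _ = set0) //; apply/seteqP; split => // t [].
  rewrite (_ : mkset _ = \bigcap_(i in [set: 'I_n])
      ((fun t : n.-tuple T => tnth t i) @^-1` b (w i))).
    apply: fin_bigcap_measurable => // i _.
    rewrite -[X in measurable X]setTI; apply: measurable_tnth => //.
    by apply: sub_sigma_algebra; exact: bo.
  by apply/seteqP; split => [t [tw _] i _|t tw]; [exact: tw|split => // i; exact: tw].
apply/seteqP; split => [t /= Vt|t [w _ [tw wV]]]; last exact: wV.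
have [w nw wV] : exists2 w : 'I_n -> set X,
    (forall i, nbhs (tnth t i : X) (w i)) & [set g | forall i, w i (g i)] `<=` V.
  exact/nbhs_prod_box/open_nbhs_nbhs.
have /choice[k kP] : forall i, exists k, b k (tnth t i) /\ b k `<=` w i.
  by move=> i; have [k ? ?] := bn _ _ (nw i); exists k.
exists [ffun i => k i] => //; split.
  by move=> i; rewrite ffunE; exact: (kP i).1.
move=> g gk; apply: wV => i; apply: (kP i).2.
by have := gk i; rewrite ffunE.
Qed.

Lemma hausdorff_basis_separation (b : nat -> set X) (x y : X) :
  (forall x V, nbhs x V -> exists2 k, b k x & b k `<=` V) -> x != y ->
  exists k l, [/\ b k x, b l y & b k `&` b l = set0].
Proof.
move=> bn; have := hX; rewrite open_hausdorff => /[apply].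
move=> [[A B] /= [/set_mem Ax /set_mem By] [oA oB /eqP AB0]].
have [k kx kA] := bn x A (open_nbhs_nbhs (conj oA Ax)).
have [l ly lB] := bn y B (open_nbhs_nbhs (conj oB By)).
exists k, l; split => //; rewrite -subset0 -AB0; exact: setISS.
Qed.

(** Distinct points have disjoint basic neighbourhoods, so the complement is a countable union of
    rectangles. This makes the tests [==], [\in] and [uniq] on points measurable. *)
Lemma measurable_borel_diag : measurable [set p : T * T | p.1 = p.2].
Proof.
have [b [bo bn]] := second_countable_enum.
rewrite -[X in measurable X]setCK; apply: measurableC.
rewrite (_ : ~` _ = \bigcup_(q : nat * nat)
    [set p | (b q.1 `*` b q.2) p /\ b q.1 `&` b q.2 = set0]).
  apply: countable_bigcupT_measurable; first exact: countableP.
  move=> [k l] /=; have [e|ne] := pselect (b k `&` b l = set0); last first.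
    by rewrite (_ : mkset _ = set0) //; apply/seteqP; split => // t [].
  rewrite (_ : mkset _ = b k `*` b l); last first.
    by apply/seteqP; split => [p []//|p]; split.
  by apply: measurableX; apply: sub_sigma_algebra; exact: bo.
apply/seteqP; split => [[x y] /= /eqP xy|[x y] [[k l] _ [[/= kx ly] kl]] /= xy].
  have [k [l [kx ly kl]]] := hausdorff_basis_separation bn xy.
  by exists (k, l).
have : (b k `&` b l) x by split => //; rewrite xy.
by rewrite kl.
Qed.

End finite_configurations.

Section configuration_sigma_algebra.
Variable X : ptopologicalType.
Hypotheses (hX : hausdorff_space X) (cX : @second_countable X).
Local Notation T := (borel X).
Local Notation Gam := (borel (Gamma0 X)).

Definition points (s : seq T) : Gam := [fset x in s]%fset.

Lemma in_points s x : (x \in (points s : Gamma0 X)) = (x \in s).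
Proof. by rewrite /points inE. Qed.

Lemma card_points s : uniq s -> #|` (points s : Gamma0 X)| = size s.
Proof. by move=> us; rewrite /points card_fseq undup_id. Qed.

Lemma measurable_uniq_tuple n : measurable [set t : n.-tuple T | uniq t].
Proof.
rewrite (_ : mkset _ = (fun t : n.-tuple T => uniq t) @^-1` [set true]) //.
rewrite -[X in measurable X]setTI.
exact: (measurable_uniq (measurable_borel_diag hX cX)
  (@measurable_id _ _ setT)).
Qed.

(** The sets [A] with this property form a sigma-algebra, complements being taken among the tuples
    of distinct points, so that open sets suffice. *)
Lemma measurable_points_preimage n (A : set Gam) : measurable A ->
  measurable [set t : n.-tuple T | uniq t /\ A (points t)].
Proof.
move: A; apply: smallest_sub; first split.
- by rewrite (_ : mkset _ = set0) //; apply/seteqP; split => // t [].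
- move=> A mA; rewrite (_ : mkset _ = [set t : n.-tuple T | uniq t] `\`
      [set t : n.-tuple T | uniq t /\ A (points t)]).
    by apply: measurableD => //; exact: measurable_uniq_tuple.
  apply/seteqP; split => t /= [ut]; first by case=> _ nA; split => // -[].
  by move=> nA; split => //; split => // At; apply: nA.
- move=> A mA; rewrite (_ : mkset _ = \bigcup_k
      [set t : n.-tuple T | uniq t /\ A k (points t)]).
    exact: bigcupT_measurable.
  apply/seteqP; split => t /=; first by case=> ut [k _ Ak]; exists k.
  by case=> k _ [ut Ak]; split => //; exists k.
(* The preimage of an open [A] is open in the subspace of injective maps, hence the trace of an open
   set [V] of the product. *)
move=> A /(_ n)/open_subspaceP[V oV VA].
rewrite (_ : mkset _ = [set t : n.-tuple T | uniq t] `&`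
                       [set t : n.-tuple T | V (tnth t)]); last first.
  have ptE (t : n.-tuple T) : of_points (tnth t : 'I_n -> X) = points t.
    rewrite /of_points /points; congr ([fset x in _]%fset).
    by rewrite codomE map_tnth_enum.
  have dis (t : n.-tuple T) : uniq t -> distinct (tnth t : 'I_n -> X).
    by move=> /tuple_uniqP.
  apply/seteqP; split => t /= [ut].
    move=> At; split => //.
    have : (V `&` distinct (n := n)) (tnth t) by rewrite VA; split;
      [rewrite /preimage /= ptE | exact: dis].
    by case.
  move=> Vt; split => //.
  have : (V `&` distinct (n := n)) (tnth t) by split => //; exact: dis.
  by rewrite VA => -[]; rewrite /preimage /= ptE.
apply: measurableI; first exact: measurable_uniq_tuple.
exact: (measurable_open_tuple cX oV).
Qed.

Lemma Gamma0_openE : @open (Gamma0 X) = @Gamma0_open X.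
Proof. by []. Qed.

(** For disjoint [U i] such a configuration has exactly one point in each, which labels its points.
    Openness is checked on [k]-tuples: for [k] other than [n] none qualifies, and for [k = n]
    hitting [U i] is an open condition. *)
Lemma open_meeting n (U : 'I_n -> set X) : (forall i, open (U i)) ->
  open [set eta : Gamma0 X | #|` eta| = n /\
        forall i, exists2 x, x \in eta & U i x].
Proof.
move=> oU; rewrite Gamma0_openE => k; apply/open_subspaceP.
have [->|kn] := eqVneq k n; last first.
  exists set0; first exact: open0.
  apply/seteqP; split => f /= -[] // [cf _] inj.
  move/eqP: kn; case; rewrite -cf /of_points card_fseq.
  by rewrite undup_id ?size_codom ?card_ord //; exact/injectiveP.
exists [set f | forall i, exists j, U i (f j)].
  rewrite openE => f Vf; rewrite /interior /=.
  apply: (@filter_forall _ _ (fun i (g : prod_topology (fun _ : 'I_n => X)) =>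
    exists j, U i (g j)) (nbhs f)) => i.
  have [j Uj] := Vf i.
  have : nbhs f ((fun g : prod_topology (fun _ : 'I_n => X) => g j) @^-1` U i).
    by apply: (@proj_continuous _ (fun=> X) j f); exact: open_nbhs_nbhs.
  by apply: filterS => g Ug; exists j.
apply/seteqP; split => f /= [Vf inj]; split => //.
  split.
    rewrite /of_points card_fseq undup_id ?size_codom ?card_ord //.
    exact/injectiveP.
  move=> i; have [j Uj] := Vf i; exists (f j) => //.
  by rewrite inE /= codom_f.
move=> i; have [_ /(_ i)[x]] := Vf.
by rewrite inE /= => /codomP[j ->]; exists j.
Qed.

End configuration_sigma_algebra.

(** * Measurable labellings of configurations *)

Section local_sections.
Variable X : ptopologicalType.
Hypotheses (hX : hausdorff_space X) (cX : @second_countable X).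
Local Notation T := (borel X).
Local Notation Gam := (borel (Gamma0 X)).

(* When the [U i] are disjoint open sets, [select U] is a measurable section of
   the enumeration map over the open set [separated U] ([point] elsewhere), and
   countably many such sets cover the configurations. *)
Definition separated n (U : 'I_n -> set X) : set (Gamma0 X) :=
  [set eta | #|` eta| = n /\ forall i, exists2 x, x \in eta & U i x].

Definition select n (U : 'I_n -> set X) (eta : Gam) : n.-tuple T :=
  [tuple xget point [set x | [/\ separated U eta, x \in (eta : Gamma0 X) & U i x]]
  | i < n].

Section disjoint.
Variables (n : nat) (U : 'I_n -> set X).
Hypothesis dU : forall i j, i != j -> U i `&` U j = set0.

Lemma tnth_select eta i : separated U eta ->
  tnth (select U eta) i \in (eta : Gamma0 X) /\ U i (tnth (select U eta) i).
Proof.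
move=> Ueta; rewrite tnth_mktuple; case: xgetP => [x -> []//|nx].
by have [_ /(_ i)[x xeta Ux]] := Ueta; case: (nx x).
Qed.

Lemma select_uniq eta : separated U eta -> uniq (select U eta).
Proof.
move=> Ueta; apply/tuple_uniqP => i j e; apply/eqP/negPn/negP => ij.
have [_ Ui] := tnth_select i Ueta; have [_ Uj] := tnth_select j Ueta.
have : (U i `&` U j) (tnth (select U eta) i) by split => //; rewrite e.
by rewrite dU.
Qed.

Lemma points_select eta : separated U eta -> points (select U eta) = eta.
Proof.
move=> Ueta; have us := select_uniq Ueta.
apply/eqP; rewrite eqEfcard; apply/andP; split.
  apply/fsubsetP => x; rewrite in_points => /tnthP[i ->].
  by have [] := tnth_select i Ueta.
by rewrite card_points // size_tuple; have [-> _] := Ueta.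
Qed.

Lemma select_unique eta i x : separated U eta -> x \in (eta : Gamma0 X) ->
  U i x -> tnth (select U eta) i = x.
Proof.
move=> Ueta; rewrite -{1}(points_select Ueta) in_points => /tnthP[j ->] Ui.
have [->//|ij] := eqVneq i j.
have [_ Uj] := tnth_select j Ueta.
have : (U i `&` U j) (tnth (select U eta) j) by [].
by rewrite dU.
Qed.

Hypothesis oU : forall i, open (U i).

Lemma measurable_separated : measurable (separated U : set Gam).
Proof. by apply: sub_sigma_algebra; exact: open_meeting. Qed.

(** The [i]-th selected point is the only point of [eta] in [U i]. It therefore lies in an open [V]
    iff [eta] is still separated after [U i] is shrunk to its part in [V]; off [separated U] the
    coordinate is constantly [point]. *)
Lemma measurable_select : measurable_fun setT (select U).
Proof.
apply/measurable_fun_tnthP => i.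
apply: (@measurability _ _ Gam T setT _ (@open X)) => // _ [V oV <-].
rewrite setTI.
pose UV j := if j == i then U i `&` V else U j.
rewrite (_ : _ @^-1` V =
  (separated UV : set Gam) `|` (~` separated U `&` [set _ | V point])).
  apply: measurableU.
    apply: sub_sigma_algebra; apply: open_meeting => j.
    by rewrite /UV; case: ifP => // _; exact: openI.
  apply: measurableI; first exact: measurableC measurable_separated.
  have [Vp|nVp] := pselect (V point).
    by rewrite (_ : mkset _ = setT) //; apply/seteqP; split.
  by rewrite (_ : mkset _ = set0) //; apply/seteqP; split.
have UVE eta : separated UV eta <-> separated U eta /\ V (tnth (select U eta) i).
  split=> [[ceta UVeta]|[Ueta Vi]].
    have Ueta : separated U eta.
      split => // j; have [x xeta] := UVeta j; rewrite /UV.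
      by case: eqP => [-> [Ux _]|_ Ux]; exists x.
    split => //; have [x xeta] := UVeta i; rewrite /UV eqxx => -[Ux Vx].
    by rewrite (select_unique Ueta xeta Ux).
  split; first by have [] := Ueta.
  move=> j; have [je Uj] := tnth_select j Ueta.
  exists (tnth (select U eta) j) => //; rewrite /UV.
  by case: eqP => // ji; rewrite -ji in Vi *.
apply/seteqP; split => eta /=.
  have [Ueta Vi|nU] := pselect (separated U eta); first by left; apply/UVE.
  rewrite tnth_mktuple; case: xgetP => [x _ []//|_ Vp]; by right.
case=> [/UVE[]//|[nU Vp]].
by rewrite tnth_mktuple; case: xgetP => // x _ [].
Qed.

End disjoint.

(** A family of basic sets is coded by a sequence of numbers: a countable type that covers families
    of every length. *)
Let nbasis (b : nat -> set X) (w : seq nat) (i : 'I_(size w)) : set X :=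
  b (nth 0%N w i).

Lemma separated_cover (b : nat -> set X) (eta : Gamma0 X) :
  (forall x V, nbhs x V -> exists2 k, b k x & b k `<=` V) ->
  exists w : seq nat, (forall i j : 'I_(size w), i != j ->
    nbasis b i `&` nbasis b j = set0) /\ separated (@nbasis b w) eta.
Proof.
move=> bn; pose s : seq X := enum_fset eta; pose n := size s.
pose x i := nth point s i.
have us : uniq s by exact: fset_uniq.
have /choice[N NP] : forall p : X * X, exists AB : set X * set X,
    p.1 != p.2 -> [/\ nbhs p.1 AB.1, nbhs p.2 AB.2 & AB.1 `&` AB.2 = set0].
  move=> [y z] /=; have [_|yz] := eqVneq y z; first by exists (setT, setT).
  have := hX; rewrite open_hausdorff => /(_ _ _ yz).
  move=> [[A B] /= [/set_mem Ay /set_mem Bz] [oA oB /eqP AB]].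
  by exists (A, B); split => //; exact: open_nbhs_nbhs.
(* [N] is chosen for ordered pairs, with no relation between its values at a pair and at the
   reversed pair; so the neighbourhood of [x i] is put into the first component for [(x i, x j)] and
   the second for [(x j, x i)]. *)
have /choice[k kP] : forall i : 'I_n, exists k, b k (x i) /\
    forall j : 'I_n, j != i ->
      b k `<=` (N (x i, x j)).1 `&` (N (x j, x i)).2.
  move=> i.
  have : nbhs (x i) [set y | forall j : 'I_n, j != i ->
      ((N (x i, x j)).1 `&` (N (x j, x i)).2) y].
    apply: filter_forall => j; have [_|ji] := eqVneq j i.
      by apply: filterS filterT => y _.
    have xij : x i != x j by rewrite nth_uniq // eq_sym.
    have [nA _ _] := NP (x i, x j) xij.
    have xji : x j != x i by rewrite eq_sym.
    have [_ nB _] := NP (x j, x i) xji.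
    by apply: filterS (filterI nA nB).
  by move=> /bn[k kx kN]; exists k; split => // j ji y /kN; apply.
exists [seq k i | i <- enum 'I_n].
have sz : size [seq k i | i <- enum 'I_n] = n by rewrite size_map size_enum_ord.
have nE (i : 'I_(size [seq k i | i <- enum 'I_n])) :
    nbasis b i = b (k (cast_ord sz i)).
  rewrite /nbasis (nth_map (cast_ord sz i)) ?size_enum_ord -?[X in (_ < X)%N]sz //.
  by congr (b (k _)); apply: val_inj; rewrite /= nth_enum_ord // -[X in (_ < X)%N]sz.
split => [i j ij|].
  rewrite !nE; set i' := cast_ord sz i; set j' := cast_ord sz j.
  have ij' : i' != j' by apply: contra ij => /eqP/cast_ord_inj ->.
  have xij : x i' != x j' by rewrite nth_uniq.
  have [_ _ N0] := NP (x i', x j') xij.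
  rewrite -subset0 -N0 => y [yi yj]; split.
    by have [_ /(_ j')] := kP i'; rewrite eq_sym => /(_ ij' y yi)[].
  by have [_ /(_ i' ij' y yj)[]] := kP j'.
split; first by rewrite sz.
move=> i; exists (x (cast_ord sz i)); last by rewrite nE; exact: (kP _).1.
by rewrite /x; apply: mem_nth; rewrite /= -[X in (_ < X)%N]sz.
Qed.

(** A converse of [measurable_points_preimage], for pairs: on each of countably many rectangles of
    separated configurations, [B] is the preimage of its set of enumerations under the measurable
    section [sel]. *)
Lemma measurable_configuration_pairs (B : set (Gam * Gam)) :
  (forall k l, measurable [set q : k.-tuple T * l.-tuple T |
    [/\ uniq q.1, uniq q.2 & B (points q.1, points q.2)]]) -> measurable B.
Proof.
move=> mB; have [b [bo bn]] := second_countable_enum cX.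
pose dis w := forall i j : 'I_(size w), i != j -> nbasis b i `&` nbasis b j = set0.
rewrite (_ : B = \bigcup_(q : seq nat * seq nat) [set p | [/\ dis q.1, dis q.2,
    (separated (@nbasis b q.1) `*` separated (@nbasis b q.2)) p & B p]]).
  apply: countable_bigcupT_measurable; first exact: countableP.
  move=> [w v] /=; have [[dw dv]|nd] := pselect (dis w /\ dis v); last first.
    by rewrite (_ : mkset _ = set0) //; apply/seteqP; split => // p [? ? _ _]; apply: nd.
  pose sel (p : Gam * Gam) := (select (@nbasis b w) p.1, select (@nbasis b v) p.2).
  have msel : measurable_fun setT sel.
    apply: measurable_fun_pair.
      by apply: measurableT_comp => //; apply: measurable_select => // i; exact: bo.
    by apply: measurableT_comp => //; apply: measurable_select => // i; exact: bo.
  rewrite (_ : mkset _ =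
    (separated (@nbasis b w) `*` separated (@nbasis b v) : set (Gam * Gam)) `&`
    sel @^-1` [set q : (size w).-tuple T * (size v).-tuple T |
      [/\ uniq q.1, uniq q.2 & B (points q.1, points q.2)]]).
    apply: measurableI.
      by apply: measurableX; apply: measurable_separated => i; exact: bo.
    by rewrite -[X in measurable X]setTI; apply: msel => //; exact: mB.
  apply/seteqP; split => [[p1 p2] [_ _ [/= s1 s2] Bp]|[p1 p2] [[/= s1 s2] [_ _]]].
    split => //; rewrite /preimage /=.
    rewrite (points_select dw s1) (points_select dv s2).
    by split => //; [exact: (select_uniq dw s1)|exact: (select_uniq dv s2)].
  by rewrite /= (points_select dw s1) (points_select dv s2).
apply/seteqP; split => [[p1 p2] Bp|p [q _ []//]].
have [w [dw sw]] := separated_cover p1 bn.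
have [v [dv sv]] := separated_cover p2 bn.
by exists (w, v).
Qed.

Lemma measurable_configurations (A : set Gam) :
  (forall k, measurable [set t : k.-tuple T | uniq t /\ A (points t)]) ->
  measurable A.
Proof.
move=> mA.
(* The statement on pairs is applied to a cylinder; [A] is its section at [point]. *)
have mAT : measurable (A `*` [set: Gam]).
  apply: measurable_configuration_pairs => k l.
  rewrite (_ : mkset _ = [set t : k.-tuple T | uniq t /\ A (points t)] `*`
                         [set t : l.-tuple T | uniq t]).
    by apply: measurableX => //; exact: measurable_uniq_tuple.
  by apply/seteqP; split => [[s t] /= [us ut []]|[s t] /= [[us As] ut]].
rewrite (_ : A = (fun eta => (eta, point)) @^-1` (A `*` [set: Gam])).
  rewrite -[X in measurable X]setTI.
  exact: (measurable_fun_pair (@measurable_id _ _ setT) (measurable_cst _)).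
by apply/seteqP; split => [eta|eta []].
Qed.

End local_sections.

(** * The signed union *)

Section signed_union.
Context (R : realType) (X : ptopologicalType).
Hypotheses (hX : hausdorff_space X) (cX : @second_countable X).
Local Notation T := (borel X).
Local Notation Gam := (borel (Gamma0 X)).

Lemma points_cat (s t : seq T) :
  points (s ++ t) = (points s `|` points t)%fset :> Gamma0 X.
Proof. by apply/fsetP => x; rewrite in_fsetU !in_points mem_cat. Qed.

Lemma measurable_on_tuples d (S : measurableType d) (f : Gam -> S) (c : S) n :
  measurable_fun setT f ->
  measurable_fun setT (fun u : n.-tuple T => if uniq u then f (points u) else c).
Proof.
move=> mf _ Y mY; rewrite setTI.
rewrite (_ : _ @^-1` _ =
  [set u : n.-tuple T | uniq u /\ (f @^-1` Y) (points u)] `|`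
  (~` [set u : n.-tuple T | uniq u] `&` [set _ | Y c])).
  apply: measurableU.
    apply: measurable_points_preimage => //.
    by rewrite -[X in measurable X]setTI; exact: mf.
  apply: measurableI; first by apply: measurableC; exact: measurable_uniq_tuple.
  have [Yc|nYc] := pselect (Y c).
    by rewrite (_ : mkset _ = setT) //; apply/seteqP; split.
  by rewrite (_ : mkset _ = set0) //; apply/seteqP; split.
apply/seteqP; split => u; rewrite /preimage /=.
  by case: ifP => [uu Yu|uu Yc]; [left|right; split => //; apply/negP/negbT].
by case=> [[-> //]|[/negP/negbTE -> //]].
Qed.

Lemma measurable_cat_tuple d (T' : measurableType d) d' (P : measurableType d')
    k l (s : P -> k.-tuple T') (t : P -> l.-tuple T') :
  measurable_fun setT s -> measurable_fun setT t ->
  measurable_fun setT (fun p => [tuple of s p ++ t p]).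
Proof.
move=> ms mt; apply/measurable_fun_tnthP => i /=.
case: (split_ordP i) => j ij.
  rewrite (_ : _ \o _ = (fun u => tnth u j) \o s).
    exact: measurableT_comp (measurable_tnth _) ms.
  by apply/funext => p /=; rewrite ij tnth_lshift.
rewrite (_ : _ \o _ = (fun u => tnth u j) \o t).
  exact: measurableT_comp (measurable_tnth _) mt.
by apply/funext => p /=; rewrite ij tnth_rshift.
Qed.

Definition signed_union (G : Gam -> R) (p : Gam * Gam) : R :=
  (-1) ^+ #|` ((p.1 : Gamma0 X) `&` p.2)%fset| *
  G ((p.1 : Gamma0 X) `|` p.2)%fset.

Variables (G : Gam -> R) (mG : measurable_fun setT G).

(* [r] collects the points of the first configuration which were found not to
   lie in [t], so that the union is reached through disjoint sequences only. *)
Let phi (s t r : seq T) : R :=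
  if uniq (s ++ r) && uniq (t ++ r) then
    (-1) ^+ #|` ((points s : Gamma0 X) `&` points t)%fset| *
    G (points (s ++ t ++ r))
  else 0.

Let phi_nil t r : phi [::] t r = if uniq (t ++ r) then G (points (t ++ r)) else 0.
Proof.
rewrite /phi /=; have -> : points [::] = fset0 :> Gamma0 X.
  by apply/fsetP => x; rewrite in_points.
rewrite fset0I cardfs0 expr0 mul1r.
by case: (boolP (uniq (t ++ r))); rewrite ?andbF // cat_uniq => /and3P[_ _ ->].
Qed.

(** If [x] lies in [t], it is a new common point, which costs one sign and leaves the union
    unchanged, while a further occurrence in [s] or [r] breaks distinctness. Otherwise [x] can be
    moved to [r]. *)
Let phi_cons x s t r : phi (x :: s) t r =
  if x \in t then (if (x \in s) || (x \in r) then 0 else - phi s t r)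
  else phi s t (x :: r).
Proof.
have cap : ((points (x :: s) : Gamma0 X) `&` points t)%fset =
    (if x \in t then x |` ((points s : Gamma0 X) `&` points t)
     else ((points s : Gamma0 X) `&` points t))%fset.
  apply/fsetP => y; rewrite in_fsetI !in_points in_cons.
  have [xt|xt] := boolP (x \in t).
    rewrite in_fset1U in_fsetI !in_points; case: eqP => //= ->.
    by rewrite xt.
  rewrite in_fsetI !in_points; case: eqP => //= ->.
  by rewrite (negbTE xt) andbF.
rewrite /phi cap /= mem_cat; have [xt|xt] := boolP (x \in t).
  case: (boolP (x \in s)) => //= xs; case: (boolP (x \in r)) => //= xr.
  case: ifP => _; last by rewrite oppr0.
  rewrite cardfsU1 in_fsetI !in_points (negbTE xs) /= add1n exprS mulN1r mulNr.
  congr (- (_ * G _)); apply/fsetP => y; rewrite !in_points in_cons.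
  by case: eqP => //= ->; rewrite !mem_cat xt orbT.
rewrite (uniq_catC s (x :: r)) (uniq_catC t (x :: r)) /=.
rewrite (uniq_catC r s) (uniq_catC r t) !mem_cat (negbTE xt) orbF orbC.
case: (boolP (x \in r)) => //= xr; case: (boolP (x \in s)) => //= xs.
congr (if _ then _ * G _ else _); apply/fsetP => y.
rewrite !in_points !(mem_cat, in_cons).
by case: (y == x); rewrite ?orbT.
Qed.

(** The recursion uses up [s]; at its end [t ++ r] enumerates the union by a tuple of fixed length,
    and measurability of [G] applies. As [r] grows on the way, [j] is kept general. *)
Let measurable_phi k l j d (P : measurableType d) (s : P -> k.-tuple T)
    (t : P -> l.-tuple T) (r : P -> j.-tuple T) :
  measurable_fun setT s -> measurable_fun setT t -> measurable_fun setT r ->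
  measurable_fun setT (fun p => phi (s p) (t p) (r p)).
Proof.
elim: k j s r => [|k IH] j s r ms mt mr.
  under eq_fun do rewrite tuple0 phi_nil.
  have mGu : measurable_fun setT (fun u : (l + j).-tuple T =>
      if uniq u then G (points u) else 0) by exact: measurable_on_tuples.
  exact: (measurableT_comp mGu (measurable_cat_tuple mt mr)).
pose x p := thead (s p); pose s' p : k.-tuple T := [tuple of behead (s p)].
have mx : measurable_fun setT x.
  exact: measurableT_comp (@measurable_thead _ T k) ms.
have ms' : measurable_fun setT s'.
  exact: measurableT_comp (@measurable_behead _ T k) ms.
rewrite (_ : (fun _ => _) = fun p => if x p \in t p then
    (if (x p \in s' p) || (x p \in r p) then 0 else - phi (s' p) (t p) (r p))
    else phi (s' p) (t p) (x p :: r p)); last first.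
  by apply/funext => p; rewrite -phi_cons [in LHS](tuple_eta (s p)).
have mdiag := measurable_borel_diag hX cX.
apply: measurable_fun_ifT.
- exact: measurable_in_tuple.
- apply: measurable_fun_ifT.
  + by apply: measurable_or; exact: measurable_in_tuple.
  + exact: measurable_cst.
  + by apply: measurable_funN; exact: IH.
- exact: (IH _ s' (fun p => [tuple of x p :: r p]) ms' mt (measurable_cons mx mr)).
Qed.

Lemma measurable_signed_union : measurable_fun setT (signed_union G).
Proof.
move=> _ Y mY; rewrite setTI.
apply: measurable_configuration_pairs => // k l.
rewrite (_ : mkset _ =
  ([set s : k.-tuple T | uniq s] `*` [set t : l.-tuple T | uniq t]) `&`
  ((fun q : k.-tuple T * l.-tuple T => phi q.1 q.2 [tuple]) @^-1` Y)).
  apply: measurableI.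
    by apply: measurableX; exact: measurable_uniq_tuple.
  rewrite -[X in measurable X]setTI.
  apply: (@measurable_phi k l 0 _ _ fst snd (fun=> [tuple])) => //.
have phiE (q : k.-tuple T * l.-tuple T) : uniq q.1 -> uniq q.2 ->
    phi q.1 q.2 [::] = signed_union G (points q.1, points q.2).
  by move=> u1 u2; rewrite /phi !cats0 u1 u2 /signed_union /= points_cat.
apply/seteqP; split => q /=.
  by case=> u1 u2 Yq; split => //; rewrite /preimage /= phiE.
by case=> [[u1 u2]]; rewrite /preimage /= phiE.
Qed.

End signed_union.

(** [f] vanishes unless [eta] lies in [L], so only the finitely many subsets of the trace of [g] on
    [L] contribute. *)
Lemma fsum_subsets (R : realType) (X : choiceType) (f : {fset X} -> R)
    (g L : set X) : finite_set (g `&` L) ->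
  (forall eta : {fset X}, ~ [set` eta] `<=` L -> f eta = 0) ->
  \sum_(eta \in [set eta : {fset X} | [set` eta] `<=` g]) f eta =
  \sum_(eta <- fpowerset (fset_set (g `&` L))) f eta.
Proof.
move=> fgL f0.
have sub (eta : {fset X}) :
    eta \in fpowerset (fset_set (g `&` L)) <-> [set` eta] `<=` g `&` L.
  rewrite fpowersetE; split=> [/fsubsetP h x /= /h|h].
    by rewrite in_fset_set // => /set_mem.
  by apply/fsubsetP => x xeta; rewrite in_fset_set //; apply/mem_set/h.
rewrite -(fsbig_widen [set` fpowerset (fset_set (g `&` L))]) /=.
- by rewrite fsbig_finite //= set_fsetK.
- by move=> eta /= /sub h x xeta; have [] := h x xeta.
- move=> eta [/= etag netaL]; apply: f0 => etaL; apply: netaL.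
  by apply/sub => x xeta; split; [exact: etag|exact: etaL].
Qed.

Section K_transform_signed_union.
Context (R : realType) (X : ptopologicalType).
Variables (G : borel (Gamma0 X) -> R) (BbsG : Bbs G).

Lemma K_transform_signed_union gp gm : Gamma gp -> Gamma gm ->
  K_transform2 (signed_union G) gp gm = K_transform G (gp `|` gm).
Proof.
move=> Ggp Ggm; have [_ _ [L [N [BcL G0]]]] := BbsG.
have G0' (eta : Gamma0 X) : ~ [set` eta] `<=` L -> G eta = 0.
  by move=> nL; apply: G0 => -[].
have fp := Ggp _ BcL; have fm := Ggm _ BcL.
rewrite /K_transform (fsum_subsets (L := L)) //; last first.
  by rewrite setIUl finite_setU.
rewrite setIUl fset_setU // -sum_fpowersetU_alternating /K_transform2.
(* A union inside [L] has both parts inside [L], so the two sums are cut down to [L] one after the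
   other. *)
transitivity (\sum_(a \in [set eta : {fset X} | [set` eta] `<=` gp])
    \sum_(b <- fpowerset (fset_set (gm `&` L))) signed_union G (a, b)).
  apply: eq_fsbigr => a _; rewrite (fsum_subsets (L := L)) // => eta nL.
  rewrite /signed_union /= G0' ?mulr0 // => aL; apply: nL => x xeta.
  by apply: aL; rewrite /= in_fsetU xeta orbT.
rewrite (fsum_subsets (L := L)) // => eta nL; apply: big1 => b _.
rewrite /signed_union /= G0' ?mulr0 // => aL; apply: nL => x xeta.
by apply: aL; rewrite /= in_fsetU xeta.
Qed.

Lemma Gamma_setU (gp gm : set X) : Gamma gp -> Gamma gm -> Gamma (gp `|` gm).
Proof. by move=> Gp Gm L BL; rewrite setIUl finite_setU; split; auto. Qed.

(** The bounds [C], [L] and [N] of [G] are inherited: the sign keeps absolute values, and each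
    component is contained in the union. *)
Lemma Bbs2_signed_union : hausdorff_space X -> @second_countable X ->
  Bbs2 (signed_union G).
Proof.
move=> hX cX; have [mG [C GC] [L [N [BcL G0]]]] := BbsG.
split; first exact: measurable_signed_union.
  by exists C => p; rewrite normrM normrX normrN1 expr1n mul1r.
exists L, N; split => // p nLN; rewrite /signed_union G0 ?mulr0 // => -[UL UN].
apply: nLN; split; split.
- by move=> x xp; apply: UL; rewrite /= in_fsetU xp.
- by apply: leq_trans UN; apply: fsubset_leq_card; exact: fsubsetUl.
- by move=> x xp; apply: UL; rewrite /= in_fsetU xp orbT.
- by apply: leq_trans UN; apply: fsubset_leq_card; exact: fsubsetUr.
Qed.

End K_transform_signed_union.

(** * The Lebesgue-Poisson measure *)

Lemma pushforward_measureP d1 d2 (T1 : measurableType d1)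
    (T2 : measurableType d2) (R : realType) (mu : {measure set T1 -> \bar R})
    (f : T1 -> T2) : measurable_fun setT f ->
  exists nu : {measure set T2 -> \bar R},
    nu = pushforward mu f :> (set T2 -> \bar R).
Proof.
move=> mf.
by exists (measure_function_pushforward__canonical__measure_function_Measure mu mf).
Qed.

Lemma ge0_integral_mrestr d (T : measurableType d) (R : realType)
    (mu : {measure set T -> \bar R}) (D : set T) (mD : measurable D)
    (f : T -> \bar R) : measurable_fun setT f -> (forall x, 0 <= f x)%E ->
  (\int[mrestr mu mD]_x f x = \int[mu]_(x in D) f x)%E.
Proof.
move=> mf f0; transitivity (\int[mrestr mu mD]_(x in setT `\` ~` D) f x)%E.
  apply: ge0_negligible_integral => //; first exact: measurableC.
  by rewrite /= /mrestr setICl measure0.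
rewrite setTD setCK; apply: eq_measure_integral => A mA AD.
by rewrite /= /mrestr setIidl.
Qed.

Section lebesgue_poisson_measure.
Context (R : realType) (X : ptopologicalType).
Hypotheses (hX : hausdorff_space X) (cX : @second_countable X).
Variable m : {sigma_finite_measure set (borel X) -> \bar R}.
Local Open Scope ereal_scope.
Local Notation T := (borel X).
Local Notation Gam := (borel (Gamma0 X)).
Local Notation mu := (tuple_measure m).

(** The empty configuration is a default that makes the map total; the power measure is restricted
    to distinct tuples before it is pushed forward along this map. *)
Definition configuration n (t : n.-tuple T) : Gam :=
  if uniq t then points t else (fset0 : Gamma0 X).

Lemma measurable_configuration n : measurable_fun setT (@configuration n).
Proof.
exact: (@measurable_on_tuples X hX cX _ Gam id (fset0 : Gamma0 X) n
  (@measurable_id _ _ setT)).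
Qed.

(** Each term is the power measure restricted to distinct tuples, pushed forward along
    [configuration] and scaled by 1/n!. This exhibits the bare set function [lebesgue_poisson m] as
    a series of measures. *)
Lemma lebesgue_poisson_series : exists nu : nat -> {measure set Gam -> \bar R},
  lebesgue_poisson m = mseries nu 0 /\
  forall n (f : Gam -> \bar R), measurable_fun setT f -> (forall eta, 0 <= f eta) ->
    \int[nu n]_eta f eta = (n`!%:R^-1)%:E *
      \int[mu n]_t (if uniq t then f (points t) else 0).
Proof.
pose muU n := mrestr (mu n) (measurable_uniq_tuple hX cX (n := n)).
have /choice[im imE] : forall n, exists nu : {measure set Gam -> \bar R},
    nu = pushforward (muU n) (@configuration n) :> (set Gam -> \bar R).
  by move=> n; apply: pushforward_measureP; exact: measurable_configuration.
have fact0 n : (0 <= n`!%:R^-1 :> R)%R by rewrite invr_ge0.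
pose nu n : {measure set Gam -> \bar R} := mscale (NngNum (fact0 n)) (im n).
exists nu; split.
  apply/funext => A; rewrite /lebesgue_poisson /mseries; apply: eq_eseriesr => n _.
  rewrite /nu /= /mscale /= imE /pushforward /muU /mrestr /image_measure.
  rewrite -tuple_measureE; congr (_ * mu n _); apply/seteqP; split => t /=.
    by case=> ut At; split => //; rewrite /preimage /= /configuration ut.
  by case=> At ut; split => //; move: At; rewrite /preimage /= /configuration ut.
move=> n f mf f0; rewrite /nu ge0_integral_mscale //; congr (_ * _).
rewrite imE (ge0_integral_pushforward (@measurable_configuration n)) // preimage_setT.
rewrite ge0_integral_mrestr; last 2 first.
- exact: (measurableT_comp mf (@measurable_configuration n)).
- by move=> t; exact: f0.
rewrite integral_mkcond; apply: eq_integral => t _.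
rewrite patchE mem_setE /= /configuration (_ : (t \in _) = uniq t) //.
by case: (uniq t).
Qed.

Lemma tuple_measure_box n (F : set T) : measurable F -> m F < +oo ->
  measurable [set t : n.-tuple T | forall x, x \in t -> F x] /\
  mu n [set t | forall x, x \in t -> F x] < +oo.
Proof.
move=> mF Foo; elim: n => [|n [mB Boo]].
  rewrite (_ : mkset _ = setT); last first.
    by apply/seteqP; split => // t _ x; rewrite tuple0.
  by split=> //; rewrite tuple_measureE /= diracT ltry.
have boxE (x : T) (t : n.-tuple T) :
    (forall y, y \in [tuple of x :: t] -> F y) <->
    F x /\ forall y, y \in t -> F y.
  split=> [h|[Fx Ft] y]; last by rewrite in_cons => /predU1P[->|/Ft].
  by split=> [|y yt]; apply: h; rewrite in_cons ?eqxx // yt orbT.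
split.
  rewrite (_ : mkset _ = (fun t : n.+1.-tuple T => thead t) @^-1` F `&`
    (fun t : n.+1.-tuple T => [tuple of behead t] : n.-tuple T) @^-1`
      [set t | forall x, x \in t -> F x]).
    apply: measurableI; rewrite -[X in measurable X]setTI.
      exact: (@measurable_thead _ T n).
    exact: (@measurable_behead _ T n).
  apply/seteqP; split => t /=; case/tupleP: t => x t; rewrite theadE.
    by move=> /boxE.
  by move=> [Fx Ft]; apply/boxE.
rewrite tuple_measureE /= -tuple_measureE /pushforward.
rewrite [ltLHS](_ : _ =
    (m \x mu n) (F `*` [set t | forall x, x \in t -> F x])); last first.
  by congr ((m \x mu n) _); apply/seteqP; split => -[x t] /= /boxE.
by rewrite product_measure1E // lte_mul_pinfty // ge0_fin_numE.
Qed.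

(** Needed for Tonelli on pairs of configurations. The exhausting sets bound the number of points
    and their location at once, which leaves finitely many terms of the series, each of them
    finite. *)
Lemma lebesgue_poisson_sigma_finite (nu : {measure set Gam -> \bar R}) :
  nu = lebesgue_poisson m :> (set Gam -> \bar R) -> sigma_finite setT nu.
Proof.
move=> nuE; have /sigma_finiteP[F [UF ndF mF]] := sigma_finiteT m.
pose E k : set Gam :=
  [set eta | (#|` (eta : Gamma0 X)| <= k)%N /\ [set` (eta : Gamma0 X)] `<=` F k].
have EE k n : [set t : n.-tuple T | uniq t /\ E k (points t)] =
    if (n <= k)%N then [set t | uniq t] `&` [set t | forall x, x \in t -> F k x]
    else set0.
  apply/seteqP; split => t /=.
    move=> [ut [+ tF]]; rewrite card_points // size_tuple => ->; split => // x xt.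
    by apply: tF; rewrite /= in_points.
  case: ifPn => // nk [ut tF]; split => //; split.
    by rewrite card_points // size_tuple.
  by move=> x; rewrite /= in_points => /tF.
have mE k n : measurable [set t : n.-tuple T | uniq t /\ E k (points t)].
  rewrite EE; case: (n <= k)%N; last exact: measurable0.
  apply: measurableI.
    exact: measurable_uniq_tuple.
  by have [mFk Fk] := mF k; have [] := tuple_measure_box n mFk Fk.
exists E.
  apply/seteqP; split => // eta _.
  have : forall x : X, exists k, F k x.
    move=> x; have : (\bigcup_k F k) x by rewrite -UF.
    by case=> k _ Fx; exists k.
  move=> /choice[k kP].
  (* The sum bounds both the cardinality and the largest index that a point of [eta] needs. *)
  pose K := (#|` (eta : Gamma0 X)| + \max_(x <- (eta : Gamma0 X)) k x)%N.
  exists K => //; split; first exact: leq_addr.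
  move=> x xeta; move: (kP x); apply/subsetPset/ndF.
  by apply: leq_trans (leq_addl _ _); apply: leq_bigmax_seq.
move=> k; split; first exact: measurable_configurations.
rewrite nuE /lebesgue_poisson (nneseries_split 0%N k.+1); last first.
  by move=> n _; rewrite mule_ge0 // ?lee_fin ?invr_ge0 // /image_measure -tuple_measureE.
rewrite [X in _ + X]eseries0 ?adde0; last first.
  move=> n kn _; rewrite /image_measure -tuple_measureE EE leqNgt ifN ?negbK //.
  by rewrite measure0 mule0.
apply: lte_sum_pinfty => n _.
rewrite lte_mul_pinfty ?lee_fin ?invr_ge0 //.
have [mFk Fk] := mF k; have [mB Boo] := tuple_measure_box n mFk Fk.
rewrite /image_measure -tuple_measureE; apply: le_lt_trans Boo.
apply: le_measure; [by apply/mem_set; exact: mE|exact/mem_set|].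
by rewrite EE; case: ifP => // _ t [].
Qed.

Lemma lebesgue_poisson_measure :
  exists nu : {sigma_finite_measure set Gam -> \bar R},
    nu = lebesgue_poisson m :> (set Gam -> \bar R) /\
    forall f : Gam -> \bar R, measurable_fun setT f -> (forall eta, 0 <= f eta) ->
      \int[nu]_eta f eta = \sum_(0 <= n <oo) (n`!%:R^-1)%:E *
        \int[mu n]_t (if uniq t then f (points t) else 0).
Proof.
have [s [sE sint]] := lebesgue_poisson_series.
have [nu nuE] := sigma_finite_measure_of (lebesgue_poisson_sigma_finite
  (nu := (mseries s 0 : {measure set Gam -> \bar R})) (esym sE)).
exists nu; split; first by rewrite nuE sE.
move=> f mf f0; rewrite nuE ge0_integral_measure_series //.
by apply: eq_eseriesr => n _; exact: sint.
Qed.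

End lebesgue_poisson_measure.

(** * The splitting identity for the Lebesgue-Poisson measure *)

Lemma eq_split_sum (T : eqType) (V : nmodType) (F G : seq T -> seq T -> V) u :
  (forall s t, perm_eq (s ++ t) u -> F s t = G s t) ->
  split_sum F u = split_sum G u.
Proof.
elim: u F G => [|x u IH] F G FG /=; first exact: FG.
congr (_ + _); apply: IH => s t stu; apply: FG.
  by rewrite /= perm_cons.
by rewrite -(cat1s x t) perm_catCA /= perm_cons.
Qed.

Lemma split_sum0 (T : eqType) (V : nmodType) (u : seq T) :
  split_sum (fun _ _ => 0 : V) u = 0.
Proof. by elim: u => //= x u ->; rewrite addr0. Qed.

Lemma split_sum_if_uniq (T : eqType) (V : nmodType) (F : seq T -> seq T -> V) u :
  split_sum (fun s t => if uniq (s ++ t) then F s t else 0) u =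
  if uniq u then split_sum F u else 0.
Proof.
case: ifP => uu; last rewrite -[RHS](split_sum0 V u).
  by apply: eq_split_sum => s t /perm_uniq ->; rewrite uu.
by apply: eq_split_sum => s t /perm_uniq ->; rewrite uu.
Qed.

(** The binomial coefficient divided by n! is 1/(k! (n-k)!); the triangle of all [k <= n] is then
    reindexed by [l = n - k]. *)
Lemma nneseries_binomial_product (R : realType) (a : nat -> nat -> \bar R) :
  (forall k l, 0 <= a k l)%E ->
  (\sum_(0 <= n <oo) (n`!%:R^-1)%:E *
    (\sum_(k < n.+1) a k (n - k)%N *+ 'C(n, k))%R =
   \sum_(0 <= k <oo) \sum_(0 <= l <oo) (k`!%:R^-1 * l`!%:R^-1)%:E * a k l)%E.
Proof.
move=> a0; pose b k l : \bar R := ((k`!%:R^-1 * l`!%:R^-1)%:E * a k l)%E.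
have b0 k l : (0 <= b k l)%E.
  by rewrite mule_ge0 // lee_fin mulr_ge0 // invr_ge0.
(* Zeros are filled in for [k > n], so that the two series can be interchanged. *)
transitivity (\sum_(0 <= n <oo) \sum_(0 <= k <oo)
    (if (k <= n)%N then b k (n - k)%N else 0))%E.
  apply: eq_eseriesr => n _; rewrite (nneseries_split 0%N n.+1); last first.
    by move=> k _; case: ifP.
  rewrite [X in (_ + X)%E]eseries0 ?adde0; last first.
    by move=> k nk _; rewrite leqNgt ifN // negbK.
  rewrite add0n big_mkord ge0_sume_distrr; last first.
    by move=> k _; elim: 'C(n, k) => // i IH; rewrite mulrS adde_ge0.
  apply: eq_bigr => k _; have kn : (k <= n)%N by rewrite -ltnS.
  rewrite kn /b.
  have -> : (a k (n - k)%N *+ 'C(n, k))%R = ('C(n, k)%:R%:E * a k (n - k)%N)%E.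
    elim: 'C(n, k) => [|i IH]; first by rewrite mulr0n mul0e.
    by rewrite mulrSr IH -natr1 EFinD ge0_muleDl ?lee_fin // mul1e.
  rewrite muleA -EFinM; congr ((_)%:E * _)%E.
  rewrite -(bin_fact kn) !natrM !invfM mulrAC mulVf ?mul1r //.
  by rewrite pnatr_eq0 -lt0n bin_gt0.
rewrite nneseries_interchange; last by move=> n k; case: ifP.
apply: eq_eseriesr => k _; rewrite (nneseries_split 0%N k); last first.
  by move=> n _; case: ifP.
rewrite [X in (X + _)%E]big1_seq ?add0e; last first.
  by move=> n; rewrite mem_index_iota add0n => /andP[_ /andP[_ nk]]; rewrite leqNgt nk.
rewrite -nneseries_addn; last by move=> n; case: ifP.
by apply: eq_eseriesr => l _; rewrite leq_addl addnK.
Qed.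

Section minlos_identity.
Context (R : realType) (X : ptopologicalType).
Hypotheses (hX : hausdorff_space X) (cX : @second_countable X).
Variable m : {sigma_finite_measure set (borel X) -> \bar R}.
Hypothesis m_nonatomic : forall x, m [set x] = 0%E.
Local Open Scope ereal_scope.
Local Notation T := (borel X).
Local Notation Gam := (borel (Gamma0 X)).
Local Notation mu := (tuple_measure m).
Let mdiag := measurable_borel_diag hX cX.

Lemma measurable_point (x : T) : measurable [set x].
Proof.
rewrite (_ : [set x] = (fun y => (x, y)) @^-1` [set p : T * T | p.1 = p.2]).
  rewrite -[X in measurable X]setTI.
  by apply: (measurable_fun_pair (measurable_cst x) (@measurable_id _ _ setT)).
by apply/seteqP; split => y /= ->.
Qed.

Lemma measurable_tuple_mem n (x : T) : measurable [set t : n.-tuple T | x \in t].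
Proof.
rewrite (_ : mkset _ = (fun t : n.-tuple T => x \in t) @^-1` [set true]) //.
rewrite -[X in measurable X]setTI.
exact: (measurable_in_tuple mdiag (measurable_cst x) (@measurable_id _ _ setT)).
Qed.

Lemma tuple_measure_mem n (x : T) : mu n [set t | x \in t] = 0.
Proof.
elim: n => [|n IH].
  by rewrite (_ : mkset _ = set0) ?measure0 //; apply/seteqP; split => t //=;
    rewrite tuple0.
rewrite tuple_measureE /= -tuple_measureE /pushforward.
rewrite (_ : _ @^-1` _ = ([set x] `*` setT) `|` (setT `*` [set t | x \in t])); last first.
  apply/seteqP; split => -[y t] /=; rewrite in_cons.
    by move=> /predU1P[->|]; [left|right].
  by case=> [[-> _]|[_ ->]]; rewrite ?eqxx ?orbT.
have mx := measurableX (measurable_point x) (@measurableT _ (n.-tuple T)).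
have mt := measurableX (@measurableT _ T) (@measurable_tuple_mem n x).
apply/eqP; rewrite eq_le measure_ge0 andbT.
apply: le_trans (measureU2 _ mx mt) _.
rewrite [X in X + _](product_measure1E m (mu n) (measurable_point x)
  (@measurableT _ (n.-tuple T))).
rewrite [X in _ + X](product_measure1E m (mu n) (@measurableT _ T)
  (@measurable_tuple_mem n x)).
(* The total masses may be infinite; both products vanish by the convention that 0 times [+oo] is
   0. *)
by rewrite m_nonatomic mul0e add0e [X in _ * X](IH : _ = 0) mule0.
Qed.

Lemma negligible_tuple_meeting n (s : seq T) :
  (mu n).-negligible [set t : n.-tuple T | has (mem t) s].
Proof.
elim: s => [|x s IH].
  by rewrite (_ : mkset _ = set0); [exact: negligible_set0|apply/seteqP; split].
rewrite (_ : mkset _ = [set t : n.-tuple T | x \in t] `|`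
                       [set t : n.-tuple T | has (mem t) s]).
  apply: negligibleU => //; exists [set t : n.-tuple T | x \in t]; split => //.
    exact: measurable_tuple_mem.
  exact: tuple_measure_mem.
by apply/seteqP; split => t /= /orP.
Qed.

Section identity.
Variable f : Gam * Gam -> \bar R.
Hypotheses (mf : measurable_fun setT f) (f0 : forall p, 0 <= f p).

(** Distinctness is asked of [s ++ t] and not of [s] and [t] separately: splitting one configuration
    yields disjoint pairs only. The overlapping pairs present in the product measure are discarded
    in [integral_disjoint]. *)
Let F (s t : seq T) := if uniq (s ++ t) then f (points s, points t) else 0.

Let F0 s t : 0 <= F s t.
Proof. by rewrite /F; case: ifP. Qed.

Let mF : seq_measurable (fun _ : unit => F).
Proof.
move=> k l; pose c (q : unit * k.-tuple T * l.-tuple T) :=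
  (configuration q.1.2, configuration q.2).
have mc : measurable_fun setT c.
  apply: measurable_fun_pair.
    apply: measurableT_comp; first exact: measurable_configuration.
    exact: measurableT_comp.
  by apply: measurableT_comp => //; exact: measurable_configuration.
rewrite (_ : (fun _ => _) =
    fun q : unit * k.-tuple T * l.-tuple T =>
      if uniq [tuple of q.1.2 ++ q.2] then f (c q) else 0).
  apply: measurable_fun_ifT => //.
  - apply: measurable_uniq => //; apply: measurable_cat_tuple => //.
    exact: measurableT_comp.
  - exact: measurableT_comp.
apply/funext => q; rewrite /F /c /configuration /=.
by case: (boolP (uniq _)) => //; rewrite cat_uniq => /and3P[-> _ ->].
Qed.

Definition sum_subconfigurations (eta : Gam) : \bar R :=
  \sum_(xi <- fpowerset (eta : Gamma0 X)) f (xi, ((eta : Gamma0 X) `\` xi)%fset).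

Lemma sum_subconfigurations_ge0 eta : 0 <= sum_subconfigurations eta.
Proof. by apply: sume_ge0 => xi _; exact: f0. Qed.

Lemma sum_subconfigurations_points (u : seq T) :
  split_sum F u = if uniq u then sum_subconfigurations (points u) else 0.
Proof.
rewrite split_sum_if_uniq; case: ifP => // uu.
exact: (split_sum_uniq (fun a b : Gamma0 X => f (a, b))).
Qed.

Lemma measurable_sum_subconfigurations : measurable_fun setT sum_subconfigurations.
Proof.
move=> _ Y mY; rewrite setTI; apply: measurable_configurations => // k.
rewrite (_ : mkset _ = [set t : k.-tuple T | uniq t] `&`
                       (fun t : k.-tuple T => split_sum F t) @^-1` Y).
  apply: measurableI; first exact: measurable_uniq_tuple.
  rewrite -[X in measurable X]setTI; apply: (measurable_split_sum_tuple mF) => //.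
apply/seteqP; split => t /= [ut];
  by rewrite /preimage /= sum_subconfigurations_points ut.
Qed.

Let integral_disjoint k l (s : k.-tuple T) : uniq s ->
  \int[mu l]_t (if uniq t then f (points s, points t) else 0) =
  \int[mu l]_t F s t.
Proof.
move=> us; apply: ge0_ae_eq_integral => //.
- apply: (@measurable_on_tuples X hX cX _ _ (fun eta => f (points s, eta))).
  apply: (measurableT_comp mf).
  by apply: measurable_fun_pair.
- pose h (t : l.-tuple T) := (tt, s, t).
  apply: (@measurableT_comp _ _ _ _ _ _ _ _ h (@mF k l)).
  by apply: measurable_fun_pair.
- by move=> t _; case: ifP.
apply: negligibleS (negligible_tuple_meeting l s) => t /= /not_implyP[_].
apply: contra_notT; rewrite /F cat_uniq us /= => nst.
by rewrite (_ : has _ _ = false) //; apply: contraNF nst => /hasP[x xt xs];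
  apply/hasP; exists x.
Qed.

Variable nu : {sigma_finite_measure set Gam -> \bar R}.
Hypothesis nuE : forall g : Gam -> \bar R, measurable_fun setT g ->
  (forall eta, 0 <= g eta) ->
  \int[nu]_eta g eta = \sum_(0 <= n <oo) (n`!%:R^-1)%:E *
    \int[mu n]_t (if uniq t then g (points t) else 0).

Lemma integral_sum_subconfigurations :
  \int[nu]_eta sum_subconfigurations eta = \int[nu \x nu]_p f p.
Proof.
have fact0 n : (0 <= n`!%:R^-1 :> R)%R by rewrite invr_ge0.
(* Both sides are expanded into this double series: the left one by [integral_split_sum], the right
   one by Tonelli and the discarding of overlapping pairs. *)
transitivity (\sum_(0 <= k <oo) \sum_(0 <= l <oo) (k`!%:R^-1 * l`!%:R^-1)%:E *
    split_integral m F k l).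
  rewrite nuE; [|exact: measurable_sum_subconfigurations
                |exact: sum_subconfigurations_ge0].
  rewrite -nneseries_binomial_product; last by move=> k l; exact: split_integral_ge0.
  apply: eq_eseriesr => n _; congr (_ * _).
  rewrite -(integral_split_sum m n mF F0); apply: eq_integral => t _.
  by rewrite sum_subconfigurations_points.
have mfx xi : measurable_fun setT (fun zeta => f (xi, zeta)).
  by apply: (measurableT_comp mf); exact: measurable_fun_pair.
rewrite fubini_tonelli1 // nuE; last 2 first.
- exact: measurable_fun_fubini_tonelli_F.
- by move=> xi; apply: integral_ge0.
apply: eq_eseriesr => k _.
transitivity ((k`!%:R^-1)%:E *
    \int[mu k]_s \sum_(0 <= l <oo) (l`!%:R^-1)%:E * \int[mu l]_t F s t); last first.
  congr (_ * _); apply: eq_integral => s _.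
  case: ifPn => us.
    rewrite /fubini_F (nuE (mfx _)) //; apply: eq_eseriesr => l _.
    by rewrite integral_disjoint.
  rewrite eseries0 // => l _ _.
  rewrite integral0_eq ?mule0 // => t _.
  by rewrite /F cat_uniq (negbTE us).
have mI l : measurable_fun setT (fun s : k.-tuple T => \int[mu l]_t F s t).
  pose h (s : k.-tuple T) := (tt, s).
  have := measurable_inner_integral m mF (fun _ => F0) (k := k) l.
  move=> /(@measurableT_comp _ _ _ _ _ _ _ _ h); apply.
  exact: measurable_fun_pair.
rewrite integral_nneseries //; last 2 first.
- by move=> l; apply: measurable_funeM.
- by move=> l s _; rewrite mule_ge0 ?lee_fin // integral_ge0.
rewrite -nneseriesZl; last first.
  move=> l _; apply: integral_ge0 => s _.
  by rewrite mule_ge0 ?lee_fin // integral_ge0.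
apply: eq_eseriesr => l _; rewrite ge0_integralZl_EFin //; last first.
  by move=> s _; apply: integral_ge0.
by rewrite muleA -EFinM.
Qed.

End identity.
End minlos_identity.

(** * Transfer of positive definiteness *)

Lemma max0_subr_max0N (R : realDomainType) (x : R) :
  Num.max x 0 - Num.max (- x) 0 = x.
Proof.
have [x0|x0] := leP x 0.
  by rewrite max_l ?oppr_ge0 // sub0r opprK.
by rewrite max_r ?oppr_le0 ?ltW // subr0.
Qed.

(** A part and its complement never meet, so the sign is 1 at every such pair, with no null set
    involved. *)
Lemma signed_union_split (R : realType) (X : ptopologicalType)
    (G : borel (Gamma0 X) -> R) (eta xi : Gamma0 X) :
  xi \in fpowerset eta -> signed_union G (xi, eta `\` xi)%fset = G eta.
Proof.
rewrite fpowersetE => /fsubsetP xieta; rewrite /signed_union /=.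
have -> : (xi `&` (eta `\` xi))%fset = fset0.
  by apply/fsetP => x; rewrite !inE; case: (x \in xi).
rewrite cardfs0 expr0 mul1r; congr G; apply/fsetP => x; rewrite !inE.
by case: (boolP (x \in xi)) => //= /xieta ->.
Qed.

Lemma sigma_finite_exhaustion (R : realType) (X : ptopologicalType)
    (m : {measure set (borel X) -> \bar R}) :
  (forall L, Bc L -> (m L < +oo)%E) ->
  (exists L : nat -> set X,
    [/\ forall n, Bc (L n), forall n, L n `<=` L n.+1 & \bigcup_n L n = setT]) ->
  sigma_finite setT m.
Proof.
move=> mfin [L [BcL _ UL]]; exists L; first by rewrite UL.
by move=> n; have [mL _] := BcL n; split => //; exact: mfin.
Qed.

Unset Implicit Arguments.

Theorem theorem5p4 (R : realType) (d : nat) (X : ptopologicalType)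
  (M : oriented_riemannian_manifold R d X)
  (Xconnected : connected [set: X])
  (Xnoncompact : ~ compact [set: X])
  (m : {measure set (borel X) -> \bar R})
  (m_radon : forall L, Bc L -> (m L < +oo)%E)
  (m_nonatomic : forall x : X, m [set x] = 0%E)
  (exhaustion : exists L : nat -> set X,
    [/\ forall n, Bc (L n), forall n, L n `<=` L n.+1 & \bigcup_n L n = setT])
  (k1 k2 : borel (Gamma0 X) -> R)
  (mk1 : measurable_fun setT k1) (mk2 : measurable_fun setT k2) :
  lenard_posdef2 m (fun p => k1 p.1 * k2 p.2) ->
  lenard_posdef m (convolution k1 k2).
Proof.
have hX := manifold_hausdorff M; have cX := manifold_second_countable M.
have [sm smE] := sigma_finite_measure_of (sigma_finite_exhaustion m_radon exhaustion).
have sm0 (x : borel X) : sm [set x] = 0%E by rewrite smE m_nonatomic.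
have [nu [nuE nuI]] := lebesgue_poisson_measure hX cX sm.
(* From here on [lebesgue_poisson m] is the bundled measure [nu], to which Tonelli applies. *)
rewrite /lenard_posdef2 /lenard_posdef -smE -nuE => posdef2 G BbsG.
have [intf posf] := posdef2 _ (Bbs2_signed_union BbsG hX cX).
pose fr (p : borel (Gamma0 X) * borel (Gamma0 X)) :=
  signed_union G p * (k1 p.1 * k2 p.2).
pose f := EFin \o fr.
have mf : measurable_fun setT f by have /integrableP[] := intf.
have mfp := measurable_funepos mf; have mfn := measurable_funeneg mf.
(* The splitting identity is used for the two parts of [f] separately. [A] and [B] need not be the
   positive and negative parts of the function in [GE]; they are nonnegative with the right
   difference. *)
pose A := sum_subconfigurations f^\+%E; pose B := sum_subconfigurations f^\-%E.
have GE : (fun eta => (G eta * convolution k1 k2 eta)%:E) = (A \- B)%E.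
  apply/funext => eta; rewrite /A /B /sum_subconfigurations.
  under eq_bigr do rewrite funeposE /f /= -EFin_max.
  under [X in (_ - X)%E]eq_bigr do rewrite funenegE /f /= -EFin_max.
  rewrite !sumEFin -EFinB; congr EFin.
  rewrite -sumrB /convolution mulr_sumr; apply: eq_big_seq => xi xieta.
  by rewrite max0_subr_max0N /fr signed_union_split.
have intA : (\int[nu]_eta A eta = \int[nu \x nu]_p f^\+ p)%E.
  exact: (integral_sum_subconfigurations hX cX sm0 mfp).
have intB : (\int[nu]_eta B eta = \int[nu \x nu]_p f^\- p)%E.
  exact: (integral_sum_subconfigurations hX cX sm0 mfn).
have A0 eta : (0 <= A eta)%E by apply: sum_subconfigurations_ge0.
have B0 eta : (0 <= B eta)%E by apply: sum_subconfigurations_ge0.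
(* [A] is nonnegative and has the integral of [f^\+], which is finite because [f] is integrable. *)
have iA : nu.-integrable setT A.
  apply/integrableP; split; first exact: measurable_sum_subconfigurations.
  under eq_integral do rewrite gee0_abs //.
  rewrite intA.
  have /integrableP[_] := integrable_funepos measurableT intf.
  by under eq_integral do rewrite gee0_abs //.
have iB : nu.-integrable setT B.
  apply/integrableP; split; first exact: measurable_sum_subconfigurations.
  under eq_integral do rewrite gee0_abs //.
  rewrite intB.
  have /integrableP[_] := integrable_funeneg measurableT intf.
  by under eq_integral do rewrite gee0_abs //.
rewrite GE; split; first exact: integrableB.
move=> KG0; rewrite integralB // intA intB -integralE.
(* The integral over the product measure becomes the iterated integral of the hypothesis, with
   [etam] outermost. *)
rewrite -(integral21_prod_meas1 intf); apply: posf => gp gm Ggp Ggm.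
rewrite K_transform_signed_union //; apply: KG0.
exact: Gamma_setU.
Qed.
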